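(* Let $(V,\ell)$ be an $N$-strict $L_\infty$-algebra with finite-dimensional components, $V_0=\mathbb{R}^n$, with $H^1(V,\ell)=0$, and let $h_1,h_2$, the norms and $\alpha_\ell$ be as in the context. Then for every $u_1\in\ker(\ell_1|_{V_0})$ with $\|u_1\|<\frac1{12\|h_1\|\alpha_\ell}$ there exists a deformation $u_t:[0,2)\to MC(V,\ell)\subset\mathbb{R}^n$ of $0$ by Maurer–Cartan elements with $\partial_{t=0}u_t=u_1$.
   Context: An $L_\infty$-algebra is a sequence $\ell=(\ell_k)_{k\geq0}$ of graded symmetric $k$-linear degree-$1$ maps $\ell_k:V^{\times k}\to V$, $\ell_0=0$, satisfying the $L_\infty$ Jacobi identities; it is $N$-strict if $\ell_k=0$ for all $k\geq N$. $H^1(V,\ell)=\ker(\ell_1:V_1\to V_2)/\operatorname{im}(\ell_1:V_0\to V_1)$. $h_1:V_1\to V_0$, $h_2:V_2\to V_1$ are linear maps with $\ell_1\circ h_1+h_2\circ\ell_1=\mathrm{id}_{V_1}$. Norms are fixed on $V_0,V_1$; $\|h_1\|$ and $\|\ell_i\|$ (for $\ell_i:V_0^{\times i}\to V_1$) are operator norms, and $\alpha_\ell=\sum_{i=1}^N\frac{\|\ell_i\|}{i!}$. $MC(v)=\sum_{k\geq1}\frac1{k!}\ell_k(v,\ldots,v)$ and $MC(V,\ell)$ is its zero set. A deformation of $0$ is a smooth path starting at $0$ consisting of Maurer–Cartan elements. *)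

(* Defs.v *)
From HB Require Import structures.
From mathcomp Require Import all_boot all_order all_algebra all_fingroup.
From mathcomp Require Import all_classical all_reals all_analysis.
Set Implicit Arguments. Unset Strict Implicit. Unset Printing Implicit Defensive.
Import Order.TTheory GRing.Theory Num.Theory.
Import numFieldNormedType.Exports.
Local Open Scope ring_scope.
Local Open Scope classical_set_scope.

(** A Z-graded real vector space with finite-dimensional components:
    the component of degree [i] is [V_i = 'rV[R]_(d i)].  An element of the
    ambient type [GV] is a family of components; only homogeneous elements
    are ever fed to the operations. *)
Section LinfDefs.
Variable R : realType.
Variable d : int -> nat.

Definition GV := forall i : int, 'rV[R]_(d i).

Definition gzero : GV := fun j => 0.

Definition homog (i : int) (x : GV) : Prop := forall j : int, j != i -> x j = 0.

Definition embed (i : int) (v : 'rV[R]_(d i)) : GV :=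
  fun j => match i =P j with
           | ReflectT e => match e in _ = j' return 'rV[R]_(d j') with erefl => v end
           | ReflectF _ => 0
           end.

Definition gcomb (c : R) (y z : GV) : GV := fun j => c *: y j + z j.

Definition ops := forall k : nat, ('I_k -> GV) -> GV.

(** Koszul sign eps(sigma; x) for inputs of degrees [s]:
    x_{sigma 0} ... x_{sigma (n-1)} = eps * x_0 ... x_{n-1}
    in the free graded-commutative algebra. *)
Definition koszul n (s : 'I_n -> int) (σ : 'S_n) : R :=
  (-1) ^+ (\sum_(a < n) \sum_(b < n | (a < b)%N && (σ b < σ a)%N)
              absz (s (σ a) * s (σ b))%R)%N.

Definition unshuffle n (i : nat) (σ : 'S_n) : bool :=
  [forall a : 'I_n, forall b : 'I_n,
     ((a < b)%N && ((b < i)%N || (i <= a)%N)) ==> (σ a < σ b)%N].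

Definition all_homog k (x : 'I_k -> GV) (s : 'I_k -> int) : Prop :=
  forall a, homog (s a) (x a).

(** An L_infinity-algebra (shifted convention: graded symmetric, all of degree 1). *)
Record is_Linf (l : ops) : Prop := {
  Linf_l0 : forall (x : 'I_0 -> GV) p, l 0%N x p = 0;
  Linf_deg : forall k (x : 'I_k -> GV) s, all_homog x s ->
      homog (\sum_(a < k) s a + 1) (l k x);
  Linf_multilin : forall k (x : 'I_k -> GV) s (a0 : 'I_k) (c : R) (y z : GV),
      all_homog x s -> homog (s a0) y -> homog (s a0) z -> forall p,
      l k (fun a => if a == a0 then gcomb c y z else x a) p =
        c *: l k (fun a => if a == a0 then y else x a) p
        + l k (fun a => if a == a0 then z else x a) p;
  Linf_sym : forall k (x : 'I_k -> GV) s (σ : 'S_k), all_homog x s -> forall p,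
      l k (fun a => x (σ a)) p = koszul s σ *: l k x p;
  Linf_jacobi : forall m (x : 'I_m.+1 -> GV) s, all_homog x s -> forall p : int,
      \sum_(1 <= i < m.+2) \sum_(σ : 'S_m.+1 | unshuffle i σ)
        koszul s σ *: l (m.+2 - i)%N (fun b : 'I_(m.+2 - i) =>
            if val b == 0%N then l i (fun a : 'I_i => x (σ (inord a)))
            else x (σ (inord (i + b - 1)))) p = 0 }.

Definition strict (N : nat) (l : ops) : Prop :=
  forall k (x : 'I_k -> GV) s, (N <= k)%N -> all_homog x s -> forall p, l k x p = 0.

Definition l10 (l : ops) (v : 'rV[R]_(d 0)) : 'rV[R]_(d 1) :=
  l 1%N (fun _ => @embed 0 v) 1.
Definition l11 (l : ops) (w : 'rV[R]_(d 1)) : 'rV[R]_(d 2) :=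
  l 1%N (fun _ => @embed 1 w) 2.

Definition lk0 (l : ops) k (v : 'I_k -> 'rV[R]_(d 0)) : 'rV[R]_(d 1) :=
  l k (fun a => @embed 0 (v a)) 1.

(** Maurer--Cartan map on V_0 (l_k = 0 for k >= N, so the series is this finite sum) *)
Definition MC (N : nat) (l : ops) (v : 'rV[R]_(d 0)) : 'rV[R]_(d 1) :=
  \sum_(1 <= k < N.+1) (k`!%:R)^-1 *: lk0 l (fun _ : 'I_k => v).

Definition opnorm_l (N0 : 'rV[R]_(d 0) -> R) (N1 : 'rV[R]_(d 1) -> R) (l : ops) (i : nat) : R :=
  sup [set N1 (lk0 l v) | v in [set v : 'I_i -> 'rV[R]_(d 0) | forall j, N0 (v j) <= 1]].

Definition alpha_l N0 N1 (N : nat) (l : ops) : R :=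
  \sum_(1 <= i < N.+1) opnorm_l N0 N1 l i / (i`!%:R).

End LinfDefs.

Definition opnorm (R : realType) m n (N1 : 'rV[R]_m -> R) (N0 : 'rV[R]_n -> R)
  (h : 'rV[R]_m -> 'rV[R]_n) : R :=
  sup [set N0 (h y) | y in [set y | N1 y <= 1]].

Definition is_norm (R : realType) n (nm : 'rV[R]_n -> R) : Prop :=
  [/\ forall x, 0 <= nm x, forall x, nm x = 0 -> x = 0,
      forall (c : R) x, nm (c *: x) = `|c| * nm x
    & forall x y, nm (x + y) <= nm x + nm y].

Definition smooth_on (R : realType) n (A : set R) (f : R -> 'rV[R]_n) : Prop :=
  forall (k : nat) t, A t -> derivable (derive1n k f) t 1.

(* Main.v *)
(** Write H = |h1| and M(v) = MC(v) - l_1(v).  The deformation is the power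
    series in t solving the Kuranishi equation u = t u_1 - h_1 (M u), obtained
    as the limit of the Picard iterates p_k, which are vector polynomials in t.

    If l_1 <> 0 on V_0 then l_1 h_1 l_1 = l_1 gives H alpha >= 1, so with
    A = 1 / (2 H alpha) <= 1 one has 3 |u_1| + H alpha A^2 <= A: all iterates
    have coefficient norm sum_m 3^m |p_{k,m}| at most A.  Successive iterates
    agree to order t^k, so their coefficients stabilise and the limit is analytic
    on |t| < 3.

    Modulo t^(k+1), MC(p_k) = h_2 l_1 (MC(p_k)).  The Bianchi identity
    l_1 (MC u) = - sum_{j >= 1} 1/j! l_{j+1} (MC u, u, ..., u), which is the
    Jacobi identity evaluated at (u, ..., u), bounds the right-hand side by
    C |t| |MC(p_k)|, whence MC(p_k) = O(t^k).  A polynomial of bounded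
    coefficient norm which is O(t^k) is at most B (t/3)^k on [0, 3], so MC
    vanishes on the limit: the neighbourhood of t = 0 on which the Bianchi
    estimate applies plays no role in the final domain.

    If l_1 = 0 on V_0, the same estimate applies to the line t u_1. *)
Require Import Defs.
From HB Require Import structures.
From mathcomp Require Import all_boot all_order all_algebra all_fingroup.
From mathcomp Require Import all_classical all_reals all_analysis.
From mathcomp Require Import ring lra zify.
Import Order.TTheory GRing.Theory Num.Theory.
Import numFieldNormedType.Exports.
Local Open Scope ring_scope.

(** * Unshuffles *)

Section Unshuffles.
Set Implicit Arguments. Unset Strict Implicit.

Let ltI n : rel 'I_n := fun a b => (a < b)%N.

Lemma card_ord_ltn n i : (i <= n)%N -> #|[set a : 'I_n | (a < i)%N]| = i.
Proof.
move=> le_in; rewrite -sum1dep_card -(big_ord_widen n (fun=> 1%N) le_in).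
by rewrite sum1_card card_ord.
Qed.

Lemma ltI_trans n : transitive (@ltI n).
Proof. by move=> a b c; exact: ltn_trans. Qed.

Lemma ltI_irr n : irreflexive (@ltI n).
Proof. by move=> a; exact: ltnn. Qed.

Lemma sorted_filter_ord n (P : pred 'I_n) : sorted (@ltI n) (seq.filter P (enum 'I_n)).
Proof.
apply: sorted_filter; first exact: ltI_trans.
by have := iota_ltn_sorted 0 n; rewrite -val_enum_ord sorted_map.
Qed.

(** The side condition says that two positions of [P], taken in order, lie in the same block of the
    unshuffle, and there [σ] is increasing. *)
Lemma unshuffle_sorted n i (σ : 'S_n) (P : pred 'I_n) : unshuffle i σ ->
  (forall a b, P a -> P b -> (a < b)%N -> (b < i)%N || (i <= a)%N) ->
  sorted (@ltI n) (map σ (seq.filter P (enum 'I_n))).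
Proof.
move=> /forallP hσ hP; rewrite sorted_map.
apply: (sub_in_sorted _ _ (sorted_filter_ord P)); last first.
  by apply/allP => a; exact: id.
move=> a b; rewrite !mem_filter => /andP[Pa _] /andP[Pb _]; rewrite /ltI /= => ab.
by have /forallP/(_ b)/implyP := hσ a; apply; rewrite ab /=; exact: hP.
Qed.

Definition first_images n i (σ : 'S_n) : {set 'I_n} := [set σ a | a : 'I_n & (a < i)%N].

(** On each block an unshuffle lists its images in increasing order, and an increasing list is
    determined by its members. The first block has members [first_images i σ] and the second has the
    complement, so the set determines both lists. *)
Lemma first_images_inj n i :
  {in [set σ : 'S_n | unshuffle i σ] &, injective (@first_images n i)}.
Proof.
move=> σ τ; rewrite !inE => hσ hτ hA.
have mem1 (ρ : 'S_n) :
    map ρ (seq.filter (fun a : 'I_n => (a < i)%N) (enum 'I_n)) =i first_images i ρ.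
  move=> b; apply/mapP/imsetP => -[a]; rewrite ?mem_filter ?inE => /=.
    by move=> /andP[ai _] ->; exists a; rewrite ?inE.
  by move=> ai ->; exists a; rewrite // mem_filter ai mem_enum.
have mem2 (ρ : 'S_n) :
    map ρ (seq.filter (fun a : 'I_n => ~~ (a < i)%N) (enum 'I_n)) =i
    ~: first_images i ρ.
  move=> b; rewrite inE -mem1; apply/mapP/idP => [[a]|].
    rewrite mem_filter => /andP[ai _] ->; apply/negP => /mapP[c].
    by rewrite mem_filter => /andP[ci _] /perm_inj ac; rewrite ac ci in ai.
  move=> nb; exists ((ρ^-1)%g b); last by rewrite permKV.
  rewrite mem_filter mem_enum andbT; apply: contra nb => h.
  by apply/mapP; exists ((ρ^-1)%g b); rewrite ?permKV // mem_filter h mem_enum.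
have s1 (ρ : 'S_n) : unshuffle i ρ ->
    sorted (@ltI n) (map ρ (seq.filter (fun a : 'I_n => (a < i)%N) (enum 'I_n))).
  by move=> h; apply: (unshuffle_sorted h) => a b _ -> .
have s2 (ρ : 'S_n) : unshuffle i ρ ->
    sorted (@ltI n) (map ρ (seq.filter (fun a : 'I_n => ~~ (a < i)%N) (enum 'I_n))).
  by move=> h; apply: (unshuffle_sorted h) => a b; rewrite -leqNgt => -> _; rewrite orbT.
have e1 := irr_sorted_eq (@ltI_trans n) (@ltI_irr n) (s1 σ hσ) (s1 τ hτ).
have e2 := irr_sorted_eq (@ltI_trans n) (@ltI_irr n) (s2 σ hσ) (s2 τ hτ).
have {}e1 := e1 (fun b => etrans (mem1 σ b)
  (etrans (congr1 (fun A : {set _} => b \in A) hA) (esym (mem1 τ b)))).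
have {}e2 := e2 (fun b => etrans (mem2 σ b)
  (etrans (congr1 (fun A : {set _} => b \in ~: A) hA) (esym (mem2 τ b)))).
apply/permP => a; have [ai|ai] := boolP (a < i)%N.
  by move/eq_in_map: e1; apply; rewrite mem_filter ai mem_enum.
by move/eq_in_map: e2; apply; rewrite mem_filter ai mem_enum.
Qed.

(** The permutation lists [A] increasingly and then its complement. The ground set is ['I_n.+1] so
    that [ord0] can serve as the default of [nth]. *)
Lemma unshuffle_of_set n (A : {set 'I_n.+1}) :
  exists2 σ : 'S_n.+1, unshuffle #|A| σ & first_images #|A| σ = A.
Proof.
pose L := enum A ++ enum (~: A).
have sL : size L = n.+1 by rewrite size_cat -!cardE cardsC card_ord.
have uL : uniq L.
  rewrite cat_uniq !enum_uniq /= andbT; apply/hasPn => a.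
  by rewrite !mem_enum inE.
have inj : injective (fun a : 'I_n.+1 => nth ord0 L a).
  by move=> a b /eqP; rewrite nth_uniq ?sL // => /eqP /val_inj.
have srt (B : {set 'I_n.+1}) : sorted (@ltI n.+1) (enum B).
  by rewrite {1}/enum_mem -enumT; exact: sorted_filter_ord.
have nthlt (B : {set 'I_n.+1}) a b : (a < b)%N -> (b < #|B|)%N ->
    (nth ord0 (enum B) a < nth ord0 (enum B) b)%N.
  move=> ab bB; apply: (sorted_ltn_nth (@ltI_trans n.+1) ord0 (srt B)) => //;
    rewrite inE -cardE //; exact: ltn_trans bB.
have hσ (a : 'I_n.+1) : perm inj a = if (a < #|A|)%N then nth ord0 (enum A) a
    else nth ord0 (enum (~: A)) (a - #|A|)%N.
  by rewrite permE nth_cat -cardE.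
exists (perm inj).
  apply/forallP => a; apply/forallP => b; apply/implyP => /andP[ab].
  rewrite !hσ => /orP[bA|Aa].
    by rewrite bA (ltn_trans ab bA); exact: nthlt.
  rewrite (ltnNge a #|A|) Aa (ltnNge b #|A|) (leq_trans Aa (ltnW ab)) /=; apply: nthlt.
    by rewrite ltn_sub2r // (leq_ltn_trans Aa).
  rewrite -(ltn_add2r #|A|) subnK ?(leq_trans Aa (ltnW ab)) // addnC cardsC card_ord.
  exact: ltn_ord.
apply/eqP; rewrite eqEcard; apply/andP; split.
  apply/fintype.subsetP => x /imsetP[a]; rewrite inE => aA ->.
  by rewrite hσ aA -mem_enum mem_nth // -cardE.
rewrite card_imset; last exact: perm_inj.
by rewrite card_ord_ltn // (leq_trans (max_card _)) // card_ord.
Qed.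

(** This count turns the sum over unshuffles in the Jacobi identity into a binomial coefficient once
    all inputs are equal. *)
Lemma card_unshuffle n i : (i <= n.+1)%N ->
  #|[set σ : 'S_n.+1 | unshuffle i σ]| = 'C(n.+1, i).
Proof.
move=> le_in; rewrite -(card_in_imset (@first_images_inj n.+1 i)).
transitivity #|[set A : {set 'I_n.+1} | #|A| == i]|; last by rewrite card_draws card_ord.
apply: eq_card => A; rewrite [RHS]inE.
apply/imsetP/eqP => [[σ _ ->]|cA].
  rewrite card_imset; last exact: perm_inj.
  exact: card_ord_ltn.
by have [σ h1 h2] := unshuffle_of_set A; exists σ; rewrite ?inE -cA.
Qed.

End Unshuffles.

Local Open Scope classical_set_scope.

(** * Norms and multilinear maps *)

Section Norms.
Set Implicit Arguments. Unset Strict Implicit.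
Variables (R : realType).

Lemma row_norm_ge n (x : 'rV[R]_n) j : `|x 0 j| <= `|x|.
Proof. by rewrite [leRHS]/Num.norm/= mx_normrE; apply: le_trans (le_bigmax _ _ (0, j)). Qed.

Lemma row_norm_le n (x : 'rV[R]_n) e : 0 <= e -> (forall j, `|x 0 j| <= e) -> `|x| <= e.
Proof.
move=> e0 h; rewrite [leLHS]/Num.norm/= mx_normrE; apply: bigmax_le => // -[i j] _ /=.
by rewrite ord1.
Qed.

Section OneNorm.
Variables (n : nat) (nm : 'rV[R]_n -> R) (hnm : is_norm nm).

Lemma nm_ge0 x : 0 <= nm x. Proof. by case: hnm. Qed.
Lemma nm_eq0 x : nm x = 0 -> x = 0. Proof. by case: hnm => _ + _ _; apply. Qed.
Lemma nmZ c x : nm (c *: x) = `|c| * nm x. Proof. by case: hnm. Qed.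
Lemma nmD x y : nm (x + y) <= nm x + nm y. Proof. by case: hnm. Qed.
Lemma nm0 : nm 0 = 0. Proof. by rewrite -(scale0r 0) nmZ normr0 mul0r. Qed.
Lemma nmN x : nm (- x) = nm x.
Proof. by rewrite -scaleN1r nmZ normrN1 mul1r. Qed.
Lemma nmB x y : nm (x - y) <= nm x + nm y.
Proof. by rewrite -(nmN y) nmD. Qed.
Lemma nm_sum I (r : seq I) (P : pred I) (F : I -> 'rV_n) :
  nm (\sum_(i <- r | P i) F i) <= \sum_(i <- r | P i) nm (F i).
Proof.
elim/big_ind2 : _ => //; first by rewrite nm0.
by move=> x a y b ha hb; apply: le_trans (nmD _ _) _; exact: lerD.
Qed.

Lemma nm_le_norm : exists2 C : R, 0 <= C & forall x, nm x <= C * `|x|.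
Proof.
exists (\sum_(j < n) nm (delta_mx 0 j)); first by apply: sumr_ge0 => j _; apply: nm_ge0.
move=> x; rewrite {1}(row_sum_delta x); apply: le_trans (nm_sum _ _ _) _.
rewrite mulr_suml; apply: ler_sum => j _; rewrite nmZ mulrC.
apply: ler_wpM2l; first exact: nm_ge0.
exact: row_norm_ge.
Qed.

Lemma nm_continuous : continuous nm.
Proof.
have [C C0 hC] := nm_le_norm.
move=> x; apply/(@cvgrPdist_le _ _ _ (nbhs x) (nbhs_filter x) nm) => e e0.
have C1 : 0 < C + 1 by lra.
apply/(@nbhs_normP R 'rV[R]_n x); exists (e / (C + 1)); first by rewrite /= divr_gt0.
move=> y /= /ltW hxy.
apply: (@le_trans _ _ (nm (x - y))).
  rewrite ler_norml; apply/andP; split.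
    by have := nmD (y - x) x; rewrite subrK -(nmN (x - y)) opprB; lra.
  by have := nmD (x - y) y; rewrite subrK; lra.
apply: le_trans (hC _) _; apply: le_trans (ler_wpM2l C0 hxy) _.
rewrite mulrA ler_pdivrMr // [e * _]mulrC; apply: ler_wpM2r; lra.
Qed.

(** By compactness the continuous function [nm] attains its minimum on the unit sphere of the sup
    norm; the minimum is positive, and its inverse is the constant. *)
Lemma norm_le_nm : exists2 C : R, 0 <= C & forall x, `|x| <= C * nm x.
Proof.
(* Without a unit vector the space is zero and any constant works. *)
have [[v v1]|noS] := pselect (exists v : 'rV[R]_n, `|v| = 1); last first.
  exists 0 => // x; rewrite mul0r; have [->|x0] := eqVneq x 0; first by rewrite normr0.
  case: noS; exists (`|x|^-1 *: x).
  by rewrite normrZ normfV normr_id mulVf // normr_eq0.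
have [||c /set_mem c1 hc] := @EVT_min_rV R n nm [set x | `|x| = 1] (ex_intro _ v v1).
- apply: bounded_closed_compact.
    by exists 1; split => // M M1 x /= ->; exact: ltW.
  rewrite (_ : [set x | _] = (@Num.norm _ 'rV[R]_n) @^-1` [set 1]) //.
  apply: (closed_comp (f := @Num.norm _ 'rV[R]_n)); last exact: closed_eq.
  by move=> x _; exact: norm_continuous.
- by apply: continuous_subspaceT; exact: nm_continuous.
have c0 : 0 < nm c.
  rewrite lt_neqAle nm_ge0 andbT eq_sym; apply/eqP => /nm_eq0 c0.
  by move: c1; rewrite /= c0 normr0 => /eqP; rewrite eq_sym oner_eq0.
exists (nm c)^-1; first by rewrite invr_ge0 ltW.
move=> x; have [->|x0] := eqVneq x 0; first by rewrite normr0 nm0 mulr0.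
have xp : 0 < `|x| by rewrite normr_gt0.
have /hc : `|x|^-1 *: x \in [set x : 'rV[R]_n | `|x| = 1].
  by apply/mem_set; rewrite /= normrZ normfV normr_id mulVf // normr_eq0.
rewrite nmZ normfV normr_id => h.
by rewrite ler_pdivlMl // -ler_pdivlMr // mulrC.
Qed.

End OneNorm.

Lemma norm_is_norm n : is_norm (fun x : 'rV[R]_n => `|x|).
Proof.
split => [x|x /eqP|c x|x y]; rewrite ?normr_ge0 //.
- by rewrite normr_eq0 => /eqP.
- exact: normrZ.
- exact: ler_normD.
Qed.

Definition upd k T (v : 'I_k -> T) (a0 : 'I_k) (y : T) : 'I_k -> T :=
  fun a => if a == a0 then y else v a.

Lemma upd_id k T (v : 'I_k -> T) a0 : upd v a0 (v a0) = v.
Proof. by apply/funext => a; rewrite /upd; case: eqP => // ->. Qed.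

Definition multilinear k m n (g : ('I_k -> 'rV[R]_m) -> 'rV[R]_n) : Prop :=
  forall v a0 c y z,
    g (upd v a0 (c *: y + z)) = c *: g (upd v a0 y) + g (upd v a0 z).

Lemma prod_ord_ltS k (F : 'I_k -> R) (j : 'I_k) :
  \prod_(a < k | (a < j.+1)%N) F a = F j * \prod_(a < k | (a < j)%N) F a.
Proof.
rewrite (bigD1 j) //=; congr (_ * _); apply: eq_bigl => a.
by rewrite ltnS [(a < j)%N]ltn_neqAle andbC.
Qed.

Lemma prod_ord_all k (F : 'I_k -> R) :
  \prod_(a < k | (a < k)%N) F a = \prod_(a < k) F a.
Proof. by apply: eq_bigl => a; rewrite ltn_ord. Qed.

Section Multilinear.
Variables (k m n : nat) (g : ('I_k -> 'rV[R]_m) -> 'rV[R]_n).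
Hypothesis hg : multilinear g.

Lemma multilinear0 v a0 : g (upd v a0 0) = 0.
Proof.
have := hg v a0 1 0 0; rewrite !scale1r addr0 => /eqP.
by rewrite -subr_eq0 opprD addrA subrr sub0r oppr_eq0 => /eqP.
Qed.

Lemma multilinearZ v a0 c y : g (upd v a0 (c *: y)) = c *: g (upd v a0 y).
Proof. by have := hg v a0 c y 0; rewrite multilinear0 !addr0. Qed.

Lemma multilinearB v a0 y z :
  g (upd v a0 (y - z)) = g (upd v a0 y) - g (upd v a0 z).
Proof. by rewrite addrC -scaleN1r hg scaleN1r addrC. Qed.

Lemma multilinear_sum v a0 I (r : seq I) (c : I -> R) (y : I -> 'rV_m) :
  g (upd v a0 (\sum_(i <- r) c i *: y i)) = \sum_(i <- r) c i *: g (upd v a0 (y i)).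
Proof.
elim: r => [|i r ih]; first by rewrite !big_nil multilinear0.
by rewrite !big_cons hg ih.
Qed.

Lemma multilinear_bounded (nm : 'rV[R]_n -> R) : is_norm nm ->
  exists2 C : R, 0 <= C & forall v, nm (g v) <= C * \prod_(a < k) `|v a|.
Proof.
move=> hnm.
(* The slots below [j] are expanded in the standard basis one at a time; the
   constant may depend on the values [x] held by the other slots. *)
suff H j : (j <= k)%N -> forall x, exists2 C : R, 0 <= C &
    forall v, (forall a : 'I_k, (j <= a)%N -> v a = x a) ->
      nm (g v) <= C * \prod_(a < k | (a < j)%N) `|v a|.
  have [C C0 hC] := H k (leqnn k) (fun=> 0).
  exists C => // v; rewrite -prod_ord_all; apply: hC => a.
  by rewrite leqNgt ltn_ord.
elim: j => [_|j ih jk] x.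
  exists (nm (g x)); first exact: nm_ge0.
  move=> v vx; rewrite big_pred0 ?mulr1 //.
  by have -> : v = x by apply/funext => a; apply: vx.
pose j' := Ordinal jk.
have /choice[C hC] : forall i : 'I_m, exists C : R, 0 <= C /\
    forall v, (forall a : 'I_k, (j <= a)%N -> v a = upd x j' (delta_mx 0 i) a) ->
      nm (g v) <= C * \prod_(a < k | (a < j)%N) `|v a|.
  by move=> i; have [C C0 hC] := ih (ltnW jk) (upd x j' (delta_mx 0 i)); exists C.
exists (\sum_i C i); first by apply: sumr_ge0 => i _; have [] := hC i.
move=> v vx; rewrite -{1}(upd_id v j') (row_sum_delta (v j')) multilinear_sum.
apply: le_trans (nm_sum hnm _ _ _) _; rewrite mulr_suml; apply: ler_sum => i _.
rewrite nmZ // (prod_ord_ltS _ j') mulrCA; apply: ler_pM => //.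
- exact: nm_ge0.
- exact: row_norm_ge.
have [_ /(_ (upd v j' (delta_mx 0 i)))] := hC i.
rewrite [X in _ * X](eq_bigr (fun a => `|v a|)); last first.
  by move=> a aj; rewrite /upd; case: eqP aj => // ->; rewrite ltnn.
apply=> a ja; rewrite /upd; case: eqP => // /eqP aj; apply: vx.
by rewrite ltn_neqAle ja andbT eq_sym.
Qed.

Lemma multilinear_lipschitz (nm : 'rV[R]_n -> R) : is_norm nm ->
  exists2 C : R, 0 <= C & forall v w r e, 0 <= r -> 0 <= e ->
    (forall a, `|v a| <= r) -> (forall a, `|w a| <= r) ->
    (forall a, `|v a - w a| <= e) -> nm (g v - g w) <= C * (e * r ^+ k.-1).
Proof.
move=> hnm; have [C C0 hC] := multilinear_bounded hnm.
exists (k%:R * C); first by rewrite mulr_ge0.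
move=> v w r e r0 e0 vr wr vwe.
(* The hybrids replace [v] by [w] one slot at a time, so consecutive values of [g] differ by a
   single evaluation with [v j' - w j'] in one slot and entries of norm at most [r] elsewhere. *)
pose hyb j := fun a : 'I_k => if (a < j)%N then w a else v a.
suff H j : (j <= k)%N -> nm (g v - g (hyb j)) <= j%:R * C * (e * r ^+ k.-1).
  have := H k (leqnn _); congr (nm (_ - g _) <= _).
  by apply/funext => a; rewrite /hyb ltn_ord.
elim: j => [_|j ih jk].
  by rewrite (_ : hyb 0%N = v) ?subrr ?nm0 ?mul0r //; apply/funext => a.
pose j' := Ordinal jk.
have hj : g (hyb j) - g (hyb j.+1) = g (upd (hyb j) j' (v j' - w j')).
  rewrite multilinearB; congr (g _ - g _); apply/funext => a; rewrite /upd /hyb.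
    by case: eqP => // ->; rewrite ltnn.
  rewrite ltnS leq_eqVlt -(inj_eq val_inj) /=; case: eqP => //= aj.
  by congr w; exact: val_inj.
rewrite -[g v - _](subrKA (g (hyb j))) hj.
apply: le_trans (nmD hnm _ _) _.
rewrite -natr1 mulrDl mulrDl mul1r; apply: lerD; first by apply: ih; exact: ltnW.
apply: le_trans (hC _) _; apply: ler_wpM2l => //.
rewrite (bigD1 j') //= {1}/upd eqxx.
apply: ler_pM => //; first by apply: prodr_ge0.
rewrite (_ : r ^+ k.-1 = \prod_(a < k | a != j') r).
  apply: ler_prod => a /negbTE aj; rewrite normr_ge0 /= /upd aj /hyb.
  by case: ifP.
by rewrite prodr_const cardC1 card_ord.
Qed.

Variables (N0 : 'rV[R]_m -> R) (N1 : 'rV[R]_n -> R).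
Hypotheses (hN0 : is_norm N0) (hN1 : is_norm N1).

Let S := [set N1 (g v) | v in [set v : 'I_k -> 'rV[R]_m | forall j, N0 (v j) <= 1]].

(** Boundedness is what makes [sup] a genuine operator norm; it follows from the bound in the sup
    norm and the equivalence of norms. *)
Lemma unit_ball_has_ubound : has_ubound S.
Proof.
have [C C0 hC] := multilinear_bounded hN1; have [c c0 hc] := norm_le_nm hN0.
exists (C * \prod_(a < k) c) => _ [v /= v1 <-].
apply: le_trans (hC v) _; apply: ler_wpM2l => //.
apply: ler_prod => a _; rewrite normr_ge0 /=; apply: le_trans (hc _) _.
by rewrite -[leRHS]mulr1; apply: ler_wpM2l.
Qed.

Lemma multilinear_sup_ge0 : 0 <= sup S.
Proof.
apply: (@le_trans _ _ (N1 (g (fun=> 0)))); first exact: nm_ge0.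
apply: ub_le_sup; first exact: unit_ball_has_ubound.
by exists (fun=> 0) => //= j; rewrite nm0.
Qed.

Lemma multilinear_le_sup v : N1 (g v) <= sup S * \prod_(a < k) N0 (v a).
Proof.
suff H j : (j <= k)%N -> forall v, (forall a : 'I_k, (j <= a)%N -> N0 (v a) <= 1) ->
    N1 (g v) <= sup S * \prod_(a < k | (a < j)%N) N0 (v a).
  by rewrite -prod_ord_all; apply: H => // a; rewrite leqNgt ltn_ord.
elim: j {v} => [_|j ih jk] v hv.
  rewrite big_pred0 // mulr1; apply: ub_le_sup; first exact: unit_ball_has_ubound.
  by exists v => //= a; apply: hv.
(* The vector [y] is the normalised slot. A slot of norm 0 is itself zero, so the convention that
   the inverse of 0 is 0 keeps the identity [vy] true. *)
pose j' := Ordinal jk; pose y := (N0 (v j'))^-1 *: v j'.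
have vy : v j' = N0 (v j') *: y.
  rewrite scalerA; have [/nm_eq0 ->//|h] := eqVneq (N0 (v j')) 0.
    by rewrite scaler0.
  by rewrite divff // scale1r.
have y1 : N0 y <= 1.
  rewrite nmZ // normfV ger0_norm ?nm_ge0 //.
  by have [->|h] := eqVneq (N0 (v j')) 0; [rewrite mulr0|rewrite mulVf].
rewrite -{1}(upd_id v j') {1}vy multilinearZ nmZ // ger0_norm ?nm_ge0 //.
rewrite (prod_ord_ltS _ j') mulrCA; apply: ler_wpM2l; first exact: nm_ge0.
have := ih (ltnW jk) (upd v j' y).
rewrite [X in _ * X](eq_bigr (fun a => N0 (v a))); last first.
  by move=> a aj; rewrite /upd; case: eqP aj => // ->; rewrite ltnn.
apply=> a ja; rewrite /upd; case: eqP => // /eqP aj; apply: hv.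
by rewrite ltn_neqAle ja andbT eq_sym.
Qed.

End Multilinear.

Section Linear.
Variables (m n : nat) (h : 'rV[R]_m -> 'rV[R]_n).
Hypothesis hlin : forall c y z, h (c *: y + z) = c *: h y + h z.
Variables (N1 : 'rV[R]_m -> R) (N0 : 'rV[R]_n -> R).
Hypotheses (hN1 : is_norm N1) (hN0 : is_norm N0).

(** Linear maps are treated as multilinear maps of arity 1, so that the bounds above carry over. *)
Let g (v : 'I_1 -> 'rV[R]_m) := h (v ord0).

Let g_multilinear : multilinear g.
Proof. by move=> v a0 c y z; rewrite /g /upd !ord1 /= hlin. Qed.

Lemma opnorm_sup : opnorm N1 N0 h =
  sup [set N0 (g v) | v in [set v : 'I_1 -> 'rV[R]_m | forall j, N1 (v j) <= 1]].
Proof.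
rewrite /opnorm; congr sup; apply/seteqP; split => [_ [y /= y1 <-]|_ [v /= v1 <-]].
  by exists (fun=> y).
by exists (v ord0).
Qed.

Lemma opnorm_ge0 : 0 <= opnorm N1 N0 h.
Proof. by rewrite opnorm_sup; exact: multilinear_sup_ge0. Qed.

Lemma le_opnorm y : N0 (h y) <= opnorm N1 N0 h * N1 y.
Proof.
rewrite opnorm_sup; have := multilinear_le_sup g_multilinear hN1 hN0 (fun=> y).
by rewrite big_ord_recl big_ord0 mulr1.
Qed.

End Linear.

End Norms.

(** * Vector polynomials with weighted coefficient norm *)

Section WeightedPolynomials.
Set Implicit Arguments. Unset Strict Implicit.
Variables (R : realType) (rho : R).
Hypothesis rho0 : 0 < rho.

(** Exponents may repeat in [s], so that sums are concatenations of
    representations; [wpoly_coef] collects equal exponents. *)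
Definition wpoly n (nm : 'rV[R]_n -> R) (A : R) (P : R -> 'rV[R]_n) : Prop :=
  exists s : seq (nat * 'rV[R]_n),
    (forall t, P t = \sum_(x <- s) t ^+ x.1 *: x.2)
    /\ \sum_(x <- s) rho ^+ x.1 * nm x.2 <= A.

Section OneNorm.
Variables (n : nat) (nm : 'rV[R]_n -> R) (hnm : is_norm nm).
Local Notation wp := (wpoly nm).

Lemma wpoly_ext A P Q : P =1 Q -> wp A P -> wp A Q.
Proof. by move=> PQ [s [hs hA]]; exists s; split => // t; rewrite -PQ. Qed.

Lemma wpoly_le A B P : A <= B -> wp A P -> wp B P.
Proof. by move=> AB [s [hs hA]]; exists s; split => //; exact: le_trans AB. Qed.

Lemma wpoly_monomial e w : wp (rho ^+ e * nm w) (fun t => t ^+ e *: w).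
Proof. by exists [:: (e, w)]; split => [t|]; rewrite big_seq1. Qed.

Lemma wpoly0 : wp 0 (fun=> 0).
Proof. by exists [::]; split => [t|]; rewrite big_nil. Qed.

Lemma wpolyD A B P Q : wp A P -> wp B Q -> wp (A + B) (fun t => P t + Q t).
Proof.
move=> [s [hs hA]] [r [hr hB]]; exists (s ++ r); split => [t|].
  by rewrite big_cat /= hs hr.
by rewrite big_cat /=; exact: lerD.
Qed.

Lemma wpoly_sum I (r : seq I) (A : I -> R) (P : I -> R -> 'rV[R]_n) :
  (forall i, wp (A i) (P i)) ->
  wp (\sum_(i <- r) A i) (fun t => \sum_(i <- r) P i t).
Proof.
move=> h; elim: r => [|i r ih].
  by rewrite big_nil; apply: wpoly_ext wpoly0 => t; rewrite big_nil.
rewrite big_cons; apply: wpoly_ext (wpolyD (h i) ih) => t /=.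
by rewrite big_cons.
Qed.

Lemma wpolyXn e A P : wp A P -> wp (rho ^+ e * A) (fun t => t ^+ e *: P t).
Proof.
move=> [s [hs hA]]; exists [seq ((e + x.1)%N, x.2) | x <- s]; split => [t|].
  rewrite big_map hs scaler_sumr; apply: eq_bigr => x _ /=.
  by rewrite scalerA exprD.
rewrite big_map /= (eq_bigr (fun x => rho ^+ e * (rho ^+ x.1 * nm x.2))).
  by rewrite -mulr_sumr ler_pM2l // exprn_gt0.
by move=> x _; rewrite exprD mulrA.
Qed.

(** Asking for all large [D] leaves the degree unnamed: two polynomials can be compared at a common
    truncation order. *)
Definition is_coefs (P : R -> 'rV[R]_n) (a : nat -> 'rV[R]_n) : Prop :=
  \forall D \near \oo, forall t, P t = \sum_(m < D) t ^+ m *: a m.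

Lemma wpoly_coef A P : wp A P -> exists2 a : nat -> 'rV[R]_n,
  is_coefs P a & forall D, \sum_(m < D) rho ^+ m * nm (a m) <= A.
Proof.
move=> [s [hs hA]]; pose D0 := (\max_(x <- s) x.1).+1.
pose a m := \sum_(x <- s | x.1 == m) x.2.
have sD D x : (D0 <= D)%N -> x \in s -> (x.1 < D)%N.
  by move=> DD xs; apply: leq_trans DD; rewrite ltnS leq_bigmax_seq.
(* The terms of [s] are grouped by exponent; no term is lost because every exponent is below
   [D0]. *)
have exch D (V : nmodType) (F : nat * 'rV[R]_n -> V) : (D0 <= D)%N ->
    \sum_(m < D) \sum_(x <- s | x.1 == m) F x = \sum_(x <- s) F x.
  move=> DD; rewrite (exchange_big_dep xpredT) //= [RHS]big_seq big_seq.
  by apply: eq_bigr => x /(sD _ _ DD) xD; rewrite (big_pred1 (Ordinal xD)) // => i.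
exists a.
  exists D0 => // D /= DD t; rewrite hs -(exch D) //; apply: eq_bigr => m _.
  by rewrite scaler_sumr; apply: eq_bigr => x /eqP ->.
move=> D; pose D' := maxn D0 D.
apply: (@le_trans _ _ (\sum_(m < D') rho ^+ m * nm (a m))).
  rewrite (big_ord_widen _ (fun m => rho ^+ m * nm (a m)) (leq_maxr D0 D)).
  rewrite [leRHS](bigID (fun m : 'I__ => (m < D)%N)) /= lerDl sumr_ge0 // => m _.
  by rewrite mulr_ge0 ?exprn_ge0 ?nm_ge0 // ltW.
apply: le_trans hA; rewrite -(exch D') ?leq_maxl //; apply: ler_sum => m _.
apply: (@le_trans _ _ (\sum_(x <- s | x.1 == m) rho ^+ m * nm x.2)).
  rewrite -mulr_sumr ler_pM2l ?exprn_gt0 //; exact: nm_sum.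
by apply: ler_sum => x /eqP ->.
Qed.

(** The germ is one-sided: only nonnegative times are estimated, and powers of [t] then need no
    absolute value. *)
Definition Opow k (P : R -> 'rV[R]_n) : Prop :=
  exists2 C : R, 0 <= C & \forall t \near (0 : R)^'+, nm (P t) <= C * t ^+ k.

Lemma Opow_ext k P Q : P =1 Q -> Opow k P -> Opow k Q.
Proof. by move=> /funext ->. Qed.

Lemma Opow0 k : Opow k (fun=> 0).
Proof. by exists 0 => //; near=> t; rewrite nm0 // mul0r. Unshelve. all: by end_near. Qed.

Lemma Opow_weak j k P : (j <= k)%N -> Opow k P -> Opow j P.
Proof.
move=> jk [C C0 hC]; exists C => //; near=> t.
have t0 : 0 < t by near: t; exact: nbhs_right_gt.
have t1 : t <= 1 by near: t; exact: nbhs_right_le.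
apply: (@le_trans _ _ (C * t ^+ k)); first by near: t.
by apply: ler_wpM2l => //; apply: ler_wiXn2l => //; exact: ltW.
Unshelve. all: by end_near. Qed.

Lemma OpowD k P Q : Opow k P -> Opow k Q -> Opow k (fun t => P t + Q t).
Proof.
move=> [C C0 hC] [B B0 hB]; exists (C + B); first exact: addr_ge0.
near=> t; apply: le_trans (nmD hnm _ _) _; rewrite mulrDl.
by apply: lerD; near: t.
Unshelve. all: by end_near. Qed.

Lemma Opow_monomial (w : 'rV[R]_n) : Opow 1 (fun t => t *: w).
Proof.
exists (nm w); first exact: nm_ge0.
near=> t; have t0 : 0 < t by near: t; exact: nbhs_right_gt.
by rewrite nmZ // gtr0_norm // mulrC.
Unshelve. all: by end_near. Qed.

End OneNorm.

Lemma Opow_bounded m n (N0 : 'rV[R]_m -> R) (N1 : 'rV[R]_n -> R) C k P Q :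
  is_norm N0 -> 0 <= C -> (forall t, N1 (Q t) <= C * N0 (P t)) ->
  Opow N0 k P -> Opow N1 k Q.
Proof.
move=> hN0 C0 hC [B B0 hB]; exists (C * B); first exact: mulr_ge0.
near=> t; apply: le_trans (hC _) _; rewrite -mulrA; apply: ler_wpM2l => //.
by near: t.
Unshelve. all: by end_near. Qed.

Lemma near0_le0 (x K : R) : (\forall t \near (0 : R)^'+, x <= K * t) -> x <= 0.
Proof.
move=> h; rewrite leNgt; apply/negP => x0.
have K0 : 0 < `|K| + 1 by rewrite ltr_wpDl.
near (0 : R)^'+ => t.
have t0 : 0 < t by near: t; exact: nbhs_right_gt.
have xt : t < x / (`|K| + 1) by near: t; apply: nbhs_right_lt; exact: divr_gt0.
have : x <= K * t by near: t.
move: xt; rewrite ltr_pdivlMr // => xt.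
have : K * t <= `|K| * t by rewrite ler_pM2r // ler_norm.
move: xt t0; rewrite mulrDr; lra.
Unshelve. all: by end_near. Qed.

Lemma wpoly_linear m n (N0 : 'rV[R]_m -> R) (N1 : 'rV[R]_n -> R) H A P
    (h : 'rV[R]_m -> 'rV[R]_n) :
  0 <= H -> (forall c y z, h (c *: y + z) = c *: h y + h z) ->
  (forall y, N1 (h y) <= H * N0 y) ->
  wpoly N0 A P -> wpoly N1 (H * A) (fun t => h (P t)).
Proof.
move=> H0 hl hH [s [hs hA]]; exists [seq (x.1, h x.2) | x <- s]; split => [t|].
  have h0 : h 0 = 0.
    have /eqP := hl 1 0 0; rewrite !scale1r addr0.
    by rewrite -subr_eq0 opprD addrA subrr sub0r oppr_eq0 => /eqP.
  rewrite hs big_map; elim: s {hs hA} => [|x s ih]; rewrite ?big_nil //.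
  by rewrite !big_cons hl ih.
rewrite big_map; apply: le_trans (ler_wpM2l H0 hA).
rewrite mulr_sumr; apply: ler_sum => x _.
by rewrite /= mulrCA ler_pM2l ?exprn_gt0.
Qed.

Lemma wpoly_multilinear k m n (g : ('I_k -> 'rV[R]_m) -> 'rV[R]_n)
    (N0 : 'rV[R]_m -> R) (N1 : 'rV[R]_n -> R) S A P :
  is_norm N0 -> is_norm N1 -> multilinear g -> 0 <= S -> 0 <= A ->
  (forall v, N1 (g v) <= S * \prod_(a < k) N0 (v a)) ->
  wpoly N0 A P -> wpoly N1 (S * A ^+ k) (fun t => g (fun=> P t)).
Proof.
move=> hN0 hN1 hg S0 A0 hS [s [hs hA]].
(* The slots below [j] hold the polynomial and the others hold fixed vectors. Expanding one more
   slot along the terms of [s] turns the factor [N0 (x j')] into the coefficient norm, at most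
   [A]. *)
suff H j : (j <= k)%N -> forall x, wpoly N1
    (S * A ^+ j * \prod_(a < k | (j <= a)%N) N0 (x a))
    (fun t => g (fun a => if (a < j)%N then P t else x a)).
  have := H k (leqnn k) (fun=> 0); rewrite big_pred0 ?mulr1; last first.
    by move=> a; rewrite leqNgt ltn_ord.
  by apply: wpoly_ext => t; congr g; apply/funext => a; rewrite ltn_ord.
elim: j => [_|j ih jk] x.
  rewrite expr0 mulr1 /=; exists [:: (0%N, g x)]; split => [t|].
    by rewrite big_seq1 expr0 scale1r.
  by rewrite big_seq1 expr0 mul1r /=; exact: hS.
pose j' := Ordinal jk.
have Pj t : g (fun a => if (a < j.+1)%N then P t else x a) =
    \sum_(y <- s) t ^+ y.1 *:
      g (fun a => if (a < j)%N then P t else upd x j' y.2 a).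
  transitivity (g (upd (fun a : 'I_k => if (a < j)%N then P t else x a) j' (P t))).
    congr g; apply/funext => a; rewrite /upd ltnS leq_eqVlt -(inj_eq val_inj) /=.
    by case: eqP.
  rewrite {2}hs multilinear_sum //; apply: eq_bigr => y _; congr (_ *: g _).
  apply/funext => a; rewrite /upd; case: eqP => // ->.
  by rewrite ltnn.
have := @wpoly_sum _ N1 _ s _ _ (fun y => wpolyXn y.1 (ih (ltnW jk) (upd x j' y.2))).
move/(wpoly_ext (fun t => esym (Pj t))); apply: wpoly_le.
rewrite (eq_bigr (fun y => (rho ^+ y.1 * N0 y.2) *
    (S * A ^+ j * \prod_(a < k | (j < a)%N) N0 (x a)))); last first.
  move=> y _; rewrite (bigD1 j') //= {1}/upd eqxx.
  rewrite (eq_big (fun a : 'I_k => (j < a)%N) (fun a => N0 (x a))).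
  - by ring.
  - by move=> a; rewrite [RHS]ltn_neqAle -(inj_eq val_inj) andbC eq_sym.
  - by move=> a /andP[_ /negbTE aj]; rewrite /upd aj.
rewrite -mulr_suml exprS.
rewrite [leRHS](_ : _ = A * (S * A ^+ j * \prod_(a < k | (j < a)%N) N0 (x a)));
  last by ring.
apply: ler_wpM2r => //; apply: mulr_ge0; first by rewrite mulr_ge0 ?exprn_ge0.
by apply: prodr_ge0 => a _; exact: nm_ge0.
Qed.

(** * Polynomials vanishing to high order at 0 *)

Section Vanishing.
Variables (n : nat) (nm : 'rV[R]_n -> R) (hnm : is_norm nm).

(** The constant term is bounded by a multiple of [t] as [t] tends to 0, hence vanishes; dividing by
    [t] lowers both the order and the degree by one. *)
Lemma Opow_coef0 k D (a : nat -> 'rV[R]_n) :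
  Opow nm k (fun t => \sum_(m < D) t ^+ m *: a m) ->
  forall m, (m < k)%N -> (m < D)%N -> a m = 0.
Proof.
elim: k D a => // k ih [//|D] a [C C0 hC].
pose Q t := \sum_(m < D) t ^+ m *: a m.+1.
have PQ t : \sum_(m < D.+1) t ^+ m *: a m = a 0%N + t *: Q t.
  rewrite big_ord_recl expr0 scale1r scaler_sumr; congr (_ + _).
  by apply: eq_bigr => m _; rewrite scalerA -exprS.
pose K := \sum_(m < D) nm (a m.+1).
have QK t : 0 <= t <= 1 -> nm (Q t) <= K.
  move=> /andP[t0 t1]; apply: le_trans (nm_sum hnm _ _ _) _.
  apply: ler_sum => m _; rewrite nmZ // ger0_norm ?exprn_ge0 //.
  by rewrite -[leRHS]mul1r; apply: ler_wpM2r; [exact: nm_ge0|exact: exprn_ile1].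
have a0 : a 0%N = 0.
  apply: (nm_eq0 hnm); apply/eqP; rewrite eq_le nm_ge0 // andbT.
  apply: (@near0_le0 _ (C + K)); near=> t.
  have t0 : 0 < t by near: t; exact: nbhs_right_gt.
  have t1 : t <= 1 by near: t; exact: nbhs_right_le.
  have -> : a 0%N = (\sum_(m < D.+1) t ^+ m *: a m) - t *: Q t by rewrite PQ addrK.
  apply: le_trans (nmB hnm _ _) _; rewrite mulrDl; apply: lerD.
    apply: (@le_trans _ _ (C * t ^+ k.+1)); first by near: t.
    rewrite exprS; apply: ler_wpM2l => //; rewrite -[leRHS]mulr1.
    by apply: ler_wpM2l; [exact: ltW|apply: exprn_ile1 => //; exact: ltW].
  rewrite nmZ // gtr0_norm // mulrC; apply: ler_wpM2r; first exact: ltW.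
  by apply: QK; rewrite t1 ltW.
have OQ : Opow nm k Q.
  exists C => //; near=> t.
  have t0 : 0 < t by near: t; exact: nbhs_right_gt.
  have : nm (\sum_(m < D.+1) t ^+ m *: a m) <= C * t ^+ k.+1 by near: t.
  rewrite PQ a0 add0r nmZ // gtr0_norm // exprS mulrCA.
  by rewrite ler_pM2l.
by case=> [|m] mk mD //; exact: (ih D (fun m => a m.+1) OQ).
Unshelve. all: by end_near. Qed.

Lemma coefs_eq k P Q a b : is_coefs P a -> is_coefs Q b ->
  Opow nm k (fun t => P t - Q t) -> forall m, (m < k)%N -> a m = b m.
Proof.
move=> ha hb O m mk; apply/eqP; rewrite -subr_eq0; apply/eqP.
near \oo => D; apply: (@Opow_coef0 k D (fun m => a m - b m)) => //.
  apply: Opow_ext O => t; have -> : P t = \sum_(m < D) t ^+ m *: a m by move: t; near: D.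
  have -> : Q t = \sum_(m < D) t ^+ m *: b m by move: t; near: D.
  by rewrite -sumrB; apply: eq_bigr => i _; rewrite scalerBr.
by near: D; exists m.+1.
Unshelve. all: by end_near. Qed.

(** For [m >= k], [t ^+ m] equals [rho ^+ m * (t / rho) ^+ m], which is at most
    [rho ^+ m * (t / rho) ^+ k] since [t / rho <= 1]. *)
Lemma coefs_tail A k P a t : is_coefs P a ->
    (forall D, \sum_(m < D) rho ^+ m * nm (a m) <= A) -> 0 <= t <= rho ->
  nm (P t - \sum_(m < k) t ^+ m *: a m) <= A * (t / rho) ^+ k.
Proof.
move=> ha hA /andP[t0 tr].
have q1 : t / rho <= 1 by rewrite ler_pdivrMr // mul1r.
have q0 : 0 <= t / rho by rewrite divr_ge0 // ltW.
near \oo => D.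
have kD : (k <= D)%N by near: D; exists k.
have -> : P t = \sum_(m < D) t ^+ m *: a m by move: t {t0 tr q1 q0}; near: D.
rewrite (big_ord_widen _ (fun m => t ^+ m *: a m) kD).
rewrite (bigID (fun m : 'I__ => (m < k)%N)) /= addrAC subrr add0r.
apply: le_trans (nm_sum hnm _ _ _) _.
apply: le_trans (ler_wpM2r (exprn_ge0 k q0) (hA D)).
rewrite [in leRHS](bigID (fun m : 'I__ => (m < k)%N)) /= mulrDl.
rewrite ler_wpDl //.
  rewrite mulr_ge0 ?exprn_ge0 // sumr_ge0 // => m _.
  by rewrite mulr_ge0 ?exprn_ge0 ?nm_ge0 // ltW.
rewrite mulr_suml; apply: ler_sum => m; rewrite -leqNgt => km.
rewrite nmZ // ger0_norm ?exprn_ge0 //.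
rewrite -[t in leLHS](divfK (lt0r_neq0 rho0)) exprMn.
rewrite [leRHS]mulrC -mulrA; apply: ler_wpM2r.
  by rewrite mulr_ge0 ?exprn_ge0 ?nm_ge0 // ltW.
exact: ler_wiXn2l.
Unshelve. all: by end_near. Qed.

(** This passes from a germ at 0 to all of [[0, rho]]: the order forces the first [k] coefficients
    to vanish, so [P] is its own tail. *)
Lemma wpoly_Opow A k P t : wpoly nm A P -> Opow nm k P -> 0 <= t <= rho ->
  nm (P t) <= A * (t / rho) ^+ k.
Proof.
move=> /wpoly_coef -/(_ hnm)[a Pa hA] OP tr.
have a0 m : (m < k)%N -> a m = 0.
  apply: (coefs_eq Pa (b := fun=> 0) (Q := fun=> 0)); last first.
    by apply: Opow_ext OP => s; rewrite subr0.
  by exists 0%N => // D _ s; rewrite big1 // => i _; rewrite scaler0.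
have := coefs_tail k Pa hA tr; rewrite big1 ?subr0 // => m _.
by rewrite a0 // scaler0.
Qed.

End Vanishing.

(** In the telescoped difference each term has one factor [P - Q] of order [j] and [k - 1 >= 1]
    further factors of order 1, which yields at least one extra order. *)
Lemma Opow_multilinear k m n (g : ('I_k -> 'rV[R]_m) -> 'rV[R]_n)
    (N0 : 'rV[R]_m -> R) (N1 : 'rV[R]_n -> R) j P Q :
  is_norm N0 -> is_norm N1 -> multilinear g -> (1 < k)%N ->
  Opow N0 1 P -> Opow N0 1 Q -> Opow N0 j (fun t => P t - Q t) ->
  Opow N1 j.+1 (fun t => g (fun=> P t) - g (fun=> Q t)).
Proof.
move=> hN0 hN1 hg k1 OP OQ OPQ.
have [c c0 hc] := norm_le_nm hN0.
have conv i F : Opow N0 i F -> Opow (fun x : 'rV[R]_m => `|x|) i F.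
  exact: (Opow_bounded hN0 c0 (fun t => hc (F t))).
have [C C0 hC] := multilinear_lipschitz hg hN1.
have [A A0 hA] := conv _ _ OP; have [B B0 hB] := conv _ _ OQ.
have [E E0 hE] := conv _ _ OPQ.
exists (C * (E * (A + B) ^+ k.-1)); first by rewrite !mulr_ge0 ?exprn_ge0 ?addr_ge0.
near=> t.
have t0 : 0 < t by near: t; exact: nbhs_right_gt.
have t1 : t <= 1 by near: t; exact: nbhs_right_le.
have hP : `|P t| <= (A + B) * t.
  rewrite -{2}[t]expr1 mulrDl; apply: (@le_trans _ _ (A * t ^+ 1)); first by near: t.
  by rewrite lerDl mulr_ge0 // exprn_ge0 // ltW.
have hQ : `|Q t| <= (A + B) * t.
  rewrite -{2}[t]expr1 mulrDl; apply: (@le_trans _ _ (B * t ^+ 1)); first by near: t.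
  by rewrite lerDr mulr_ge0 // exprn_ge0 // ltW.
have hPQ : `|P t - Q t| <= E * t ^+ j by near: t.
have r0 : 0 <= (A + B) * t by rewrite mulr_ge0 ?addr_ge0 // ltW.
have e0 : 0 <= E * t ^+ j by rewrite mulr_ge0 ?exprn_ge0 // ltW.
apply: le_trans (hC _ _ _ _ r0 e0 (fun=> hP) (fun=> hQ) (fun=> hPQ)) _.
rewrite -!mulrA; apply: ler_wpM2l => //; apply: ler_wpM2l => //.
rewrite exprMn mulrCA; apply: ler_wpM2l; first by rewrite exprn_ge0 ?addr_ge0.
rewrite -exprD; apply: (ler_wiXn2l (ltW t0) t1).
by case: k k1 {g hg hC} => [|[|k]] //= _; rewrite addnS ltnS leq_addr.
Unshelve. all: by end_near. Qed.

End WeightedPolynomials.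

(** * Power series *)

Section PowerSeries.
Set Implicit Arguments. Unset Strict Implicit.
Variables (R : realType) (rho : R).

Lemma midpoint_between (a b : R) : 0 <= a -> a < b -> exists2 K, 0 < K & a < K < b.
Proof. by move=> a0 ab; exists ((a + b) / 2); [lra|apply/andP; split; lra]. Qed.

(** This is the Cauchy-Hadamard form of a radius of convergence at least [rho]; unlike convergence,
    it passes to the differentiated series by an elementary estimate. *)
Definition radius_ge (c : nat -> R) : Prop :=
  forall s, 0 < s < rho -> exists C, forall n, `|c n| * s ^+ n <= C.

Lemma cvg_pseries_radius c x : radius_ge c -> `|x| < rho -> cvgn (pseries c x).
Proof.
move=> hc xr; have [s s0 /andP[xs sr]] := midpoint_between (normr_ge0 x) xr.
have [|C hC] := hc s; first by rewrite s0.
have C0 : 0 <= C.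
  by apply: le_trans (hC 0%N); rewrite mulr_ge0 ?exprn_ge0 // ltW.
apply: normed_cvg; apply: (@series_le_cvg _ _ (geometric C (`|x| / s))).
- by move=> n /=.
- by move=> n /=; rewrite mulr_ge0 ?exprn_ge0 // divr_ge0 // ltW.
- move=> n /=; rewrite normrM normrX expr_div_n mulrCA mulrC.
  apply: ler_wpM2l; first by rewrite exprn_ge0.
  by rewrite ler_pdivlMr ?exprn_gt0.
- apply: is_cvg_geometric_series; rewrite normrM normfV normr_id (gtr0_norm s0).
  by rewrite ltr_pdivrMr // mul1r.
Qed.

Lemma bernoulli (e : R) n : 0 <= e -> 1 + n%:R * e <= (1 + e) ^+ n.
Proof.
move=> e0; elim: n => [|n ih]; first by rewrite mul0r addr0 expr0.
rewrite exprS; apply: (@le_trans _ _ ((1 + e) * (1 + n%:R * e))).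
  have : 0 <= e * (n%:R * e) by rewrite !mulr_ge0.
  rewrite -natr1; lra.
by apply: ler_wpM2l => //; lra.
Qed.

Lemma radius_ge_diffs c : radius_ge c -> radius_ge (pseries_diffs c).
Proof.
move=> hc s /andP[s0 sr]; have [s' s'0 /andP[ss' s'r]] := midpoint_between (ltW s0) sr.
have [|C hC] := hc s'; first by rewrite s'0.
have C0 : 0 <= C.
  by apply: le_trans (hC 0%N); rewrite mulr_ge0 ?exprn_ge0 // ltW.
(* Since [s' = (1 + e) * s], Bernoulli's inequality lets the growth from [s] to [s'] absorb the
   factor [n.+1] produced by differentiation. *)
pose e := s' / s - 1.
have e0 : 0 < e by rewrite /e subr_gt0 ltr_pdivlMr // mul1r.
exists ((1 + e^-1) * C / s') => n; rewrite /pseries_diffs normrM ger0_norm //.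
have h1 : n.+1%:R * s ^+ n <= (1 + e^-1) * s' ^+ n.
  have -> : s' = (1 + e) * s by rewrite /e addrC subrK divfK // lt0r_neq0.
  rewrite exprMn mulrA; apply: ler_wpM2r; first by rewrite exprn_ge0 // ltW.
  apply: (@le_trans _ _ ((1 + e^-1) * (1 + n%:R * e))); last first.
    apply: ler_wpM2l; last by apply: bernoulli; exact: ltW.
    by rewrite addr_ge0 // invr_ge0 ltW.
  rewrite mulrDl mul1r [n%:R * e]mulrC mulrDr mulr1 mulKf ?lt0r_neq0 //.
  have ei : 0 < e^-1 by rewrite invr_gt0.
  have : 0 <= e * n%:R by rewrite mulr_ge0 // ltW.
  rewrite -natr1; lra.
have h2 : `|c n.+1| * s' ^+ n <= C / s'.
  by rewrite ler_pdivlMr // -mulrA -exprSr.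
apply: (@le_trans _ _ (`|c n.+1| * ((1 + e^-1) * s' ^+ n))).
  rewrite mulrAC mulrC; exact: ler_wpM2l.
rewrite mulrCA -[leRHS]mulrA; apply: ler_wpM2l => //.
by rewrite addr_ge0 // invr_ge0 ltW.
Qed.

Lemma is_derive_pseries c (x : R) : radius_ge c -> `|x| < rho ->
  is_derive x (1 : R) (fun y => limn (pseries c y)) (limn (pseries (pseries_diffs c) x)).
Proof.
(* The rule for differentiating a series term by term asks for convergence of the series and its
   first two derived series at a point [K] farther out than [x]. *)
move=> hc xr; have [K K0 /andP[xK Kr]] := midpoint_between (normr_ge0 x) xr.
rewrite -(gtr0_norm K0) in Kr.
apply: (@pseries_snd_diffs _ c K).
- exact: cvg_pseries_radius.
- by apply: cvg_pseries_radius => //; exact: radius_ge_diffs.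
- by apply: cvg_pseries_radius => //; do 2 apply: radius_ge_diffs.
- by rewrite (gtr0_norm K0).
Qed.

Lemma radius_ge_iter_diffs k c : radius_ge c -> radius_ge (iter k (@pseries_diffs R) c).
Proof. by move=> hc; elim: k => //= k ih; exact: radius_ge_diffs. Qed.

Lemma pseries_at0 (c : nat -> R) : limn (pseries c 0) = c 0%N.
Proof.
apply: cvg_lim => //; rewrite -cvg_shiftS /=.
rewrite [X in X @ _ --> _](_ : _ = cst (c 0%N)); first exact: cvg_cst.
apply/funext => n; rewrite /pseries /series /= big_nat_recl //= expr0 mulr1.
by rewrite big1 ?addr0 // => i _; rewrite expr0n mulr0.
Qed.

Definition pseries_rV n (c : 'I_n -> nat -> R) (t : R) : 'rV[R]_n :=
  \row_j limn (pseries (c j) t).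

Lemma derivable_pseries_rV n (c : 'I_n -> nat -> R) t :
  (forall j, radius_ge (c j)) -> `|t| < rho ->
  derivable (pseries_rV c) t 1 /\
  derive1 (pseries_rV c) t = pseries_rV (fun j => pseries_diffs (c j)) t.
Proof.
move=> hc tr.
have hd j := is_derive_pseries (hc j) tr.
have fE i j : (fun x => pseries_rV c x i j) = (fun x => limn (pseries (c j) x)).
  by apply/funext => x; rewrite mxE.
have dr : derivable (pseries_rV c) t 1.
  by apply/derivable_mxP => i j; rewrite fE; have [] := hd j.
split => //; rewrite derive1E derive_mx //; apply/matrixP => i j.
by rewrite !mxE fE; have [_ ->] := hd j.
Qed.

Lemma near_norm_lt (t : R) : `|t| < rho -> \forall x \near t, `|x| < rho.
Proof.
move=> tr; have /near_in_itvoo : t \in `]- rho, rho[%R by rewrite in_itv /= -ltr_norml.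
by apply: filterS => x; rewrite in_itv /= -ltr_norml.
Qed.

Lemma derive1n_pseries_rV n (c : 'I_n -> nat -> R) k t :
  (forall j, radius_ge (c j)) -> `|t| < rho ->
  derive1n k (pseries_rV c) t = pseries_rV (fun j => iter k (@pseries_diffs R) (c j)) t.
Proof.
move=> hc; elim: k t => // k ih t tr.
have h j := radius_ge_iter_diffs k (hc j).
(* The induction hypothesis holds on a whole neighbourhood of [t], which is what differentiating it
   requires. *)
rewrite derive1nS derive1E (near_eq_derive
  (g := pseries_rV (fun j => iter k (@pseries_diffs R) (c j)))).
  by rewrite -derive1E; have [_ ->] := derivable_pseries_rV h tr.
near=> x; apply: ih.
by near: x; exact: near_norm_lt.
Unshelve. all: by end_near. Qed.

Lemma smooth_pseries_rV n (c : 'I_n -> nat -> R) :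
  (forall j, radius_ge (c j)) -> smooth_on [set t | - rho < t < rho] (pseries_rV c).
Proof.
move=> hc k t /= tr; have {}tr : `|t| < rho by rewrite ltr_norml.
have h j := radius_ge_iter_diffs k (hc j).
apply: (near_eq_derivable (f := pseries_rV (fun j => iter k (@pseries_diffs R) (c j)))).
  near=> x; apply/esym/derive1n_pseries_rV => //.
  by near: x; exact: near_norm_lt.
by have [] := derivable_pseries_rV h tr.
Unshelve. all: by end_near. Qed.

End PowerSeries.

(** * Analytic limit of stabilising polynomials *)

Section Limit.
Set Implicit Arguments. Unset Strict Implicit.
Variables (R : realType) (rho : R).
Hypothesis rho0 : 0 < rho.
Variables (n : nat) (nm : 'rV[R]_n -> R) (hnm : is_norm nm).

Lemma smooth_limit A (p : nat -> R -> 'rV[R]_n) (u1 : 'rV[R]_n) :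
    (forall k, wpoly rho nm A (p k)) ->
    (forall k, Opow nm k.+1 (fun t => p k.+1 t - p k t)) ->
    (forall t, p 0%N t = 0) -> (forall t, p 1%N t = t *: u1) ->
  exists u : R -> 'rV[R]_n,
    [/\ smooth_on [set t | - rho < t < rho] u, u 0 = 0, derive1 u 0 = u1 &
      forall t e, 0 <= t < rho -> 0 < e -> \forall k \near \oo, nm (p k t - u t) <= e].
Proof.
move=> hp hO p0 p1.
have /choice[a ha] : forall k, exists a, is_coefs (p k) a /\
    forall D, \sum_(m < D) rho ^+ m * nm (a m) <= A.
  by move=> k; have [a ? ?] := wpoly_coef rho0 hnm (hp k); exists a.
(* The coefficient of order [m] no longer changes from stage [m] on, so the diagonal is the sequence
   of limit coefficients. *)
pose v m := a m m.
have av k m : (m <= k)%N -> a k m = v m.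
  elim: k => [|k ih]; first by rewrite leqn0 => /eqP ->.
  rewrite leq_eqVlt => /orP[/eqP -> //|mk].
  have [[ak _] [ak1 _]] := (ha k, ha k.+1).
  by rewrite -ih //; exact: (coefs_eq hnm ak1 ak (hO k)).
have v0 : v 0%N = 0.
  apply: (@coefs_eq _ _ _ hnm 1 (p 0%N) (fun=> 0) (a 0%N) (fun=> 0)) => //.
  - by have [] := ha 0%N.
  - by exists 0%N => // D _ s; rewrite big1 // => i _; rewrite scaler0.
  - by apply: Opow_ext (Opow0 hnm 1) => t; rewrite p0 subr0.
have v1 : v 1%N = u1.
  apply: (@coefs_eq _ _ _ hnm 2 (p 1%N) (fun t => t *: u1) (a 1%N)
    (fun m => if m == 1%N then u1 else 0)) => //.
  - by have [] := ha 1%N.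
  - exists 2%N => // D /= D2 s; rewrite (bigD1 (Ordinal D2)) //= expr1 big1 ?addr0 //.
    by move=> i /negbTE; rewrite -(inj_eq val_inj) /= => ->; rewrite scaler0.
  - by apply: Opow_ext (Opow0 hnm 2) => t; rewrite p1 subrr.
have A0 : 0 <= A by have [_ /(_ 0%N)] := ha 0%N; rewrite big_ord0.
have vA m : nm (v m) * rho ^+ m <= A.
  have [_ /(_ m.+1)] := ha m; rewrite big_ord_recr /= -/(v m) mulrC; apply: le_trans.
  by rewrite lerDr sumr_ge0 // => i _; rewrite mulr_ge0 ?nm_ge0 ?exprn_ge0 // ltW.
have [C C0 hC] := norm_le_nm hnm; have [B B0 hB] := nm_le_norm hnm.
pose c j m := v m 0 j.
have cr j : radius_ge rho (c j).
  move=> s /andP[s0 sr]; exists (C * A) => m.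
  apply: (@le_trans _ _ (C * (nm (v m) * rho ^+ m))); last exact: ler_wpM2l.
  rewrite mulrA; apply: ler_pM => //; first by rewrite exprn_ge0 // ltW.
    exact: le_trans (row_norm_ge _ _) (hC _).
  by apply: lerXn2r; rewrite ?nnegrE; exact: ltW.
have rho00 : `|0 : R| < rho by rewrite normr0.
exists (pseries_rV c); split.
- exact: smooth_pseries_rV.
- by apply/rowP => j; rewrite !mxE pseries_at0 /c v0 mxE.
- have [_ ->] := derivable_pseries_rV cr rho00.
  by apply/rowP => j; rewrite !mxE pseries_at0 /pseries_diffs mul1r /c v1.
move=> t e /andP[t0 tr] e0.
have q1 : `|t / rho| < 1.
  by rewrite ger0_norm ?divr_ge0 ?(ltW rho0) // ltr_pdivrMr // mul1r.
have B1 : 0 < 2 * (B + 1) by lra.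
near=> k.
(* Half of [e] pays for the tail of [p k] beyond order [k], the other half for the tail of the limit
   series. Up to order [k] the two have the same coefficients. *)
rewrite -(subrKA (\sum_(m < k) t ^+ m *: v m)).
apply: le_trans (nmD hnm _ _) _; rewrite [leRHS]splitr; apply: lerD.
  have -> : \sum_(m < k) t ^+ m *: v m = \sum_(m < k) t ^+ m *: a k m.
    by apply: eq_bigr => i _; rewrite av // ltnW.
  have [hk hkA] := ha k.
  apply: le_trans (coefs_tail rho0 hnm k hk hkA _) _; first by rewrite t0 ltW.
  rewrite -[leLHS]ger0_norm ?mulr_ge0 ?exprn_ge0 ?divr_ge0 ?(ltW rho0) //.
  near: k; apply: cvgr0_norm_le; last by rewrite divr_gt0.
  exact: (cvg_geometric A q1).
apply: le_trans (hB _) _.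
have : `|\sum_(m < k) t ^+ m *: v m - pseries_rV c t| <= e / (2 * (B + 1)).
  apply: row_norm_le; first by rewrite divr_ge0 // ltW.
  near: k; apply: filter_forall => j.
  have tn : `|t| < rho by rewrite ger0_norm.
  have /cvgrPdist_le/(_ (e / (2 * (B + 1)))) := cvg_pseries_radius (cr j) tn.
  rewrite divr_gt0 // => /(_ isT); apply: filterS => k.
  rewrite distrC; congr (`|_| <= _); rewrite !mxE; congr (_ - _).
  rewrite /pseries /series /= big_mkord summxE; apply: eq_bigr => i _.
  by rewrite mxE mulrC.
rewrite ler_pdivlMr // => h.
have := normr_ge0 (\sum_(m < k) t ^+ m *: v m - pseries_rV c t).
move: h; set x := `|_| => h x0; rewrite ler_pdivlMr //.
by apply: le_trans h; rewrite mulrC mulrA [leRHS]mulrC; apply: ler_wpM2r => //; lra.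
Unshelve. all: by end_near. Qed.

End Limit.

(** * The Bianchi identity *)

Section Bianchi.
Set Implicit Arguments. Unset Strict Implicit.

(** The antidiagonals [j + k = n] with [n < M + M] cover the square of side [M]; whatever else they
    meet is zero. *)
Lemma sum_triangle (V : nmodType) (c : nat -> nat -> V) M :
  (forall j k, (M <= j)%N || (M <= k)%N -> c j k = 0) ->
  \sum_(n < M + M) \sum_(i < n.+1) c (n - i)%N i = \sum_(j < M) \sum_(k < M) c j k.
Proof.
move=> c0.
transitivity (\sum_(n < M + M) \sum_(i < M + M | (i < n.+1)%N) c (n - i)%N i).
  by apply: eq_bigr => n _; rewrite (big_ord_widen _ (fun i => c (n - i)%N i) (ltn_ord n)).
rewrite (exchange_big_dep xpredT) //=.
rewrite big_split_ord /= addrC big1 ?add0r; last first.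
  by move=> i _; apply: big1 => n _; rewrite c0 // leq_addr orbT.
rewrite [RHS]exchange_big; apply: eq_bigr => i _ /=.
have iM : (i <= M + M)%N by rewrite (leq_trans (ltnW (ltn_ord i))) // leq_addr.
rewrite (big_ord_widen_cond (M + M) xpredT (fun j => c j i)) ?leq_addr //=.
rewrite -!(big_mkord (fun n => (i < n.+1)%N) (fun n => c (n - i)%N i)).
rewrite -(big_mkord (fun n => (n < M)%N) (fun n => c n i)).
rewrite (big_cat_nat (leq0n i) iM) /= big_nat_cond big_pred0 ?add0r; last first.
  by move=> n; apply/negbTE/negP => /andP[/andP[_ ni]]; rewrite ltnS leqNgt ni.
rewrite big_nat_cond (eq_bigl (fun n => (i <= n < M + M)%N)); last first.
  by move=> n; rewrite ltnS; case: (leqP i n); rewrite ?andbT ?andbF.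
rewrite -big_nat -{1}[nat_of_ord i]add0n big_addn.
rewrite (eq_bigr (fun n => c n i)); last by move=> n _; rewrite addnK.
have iM' : (M + M - i <= M + M)%N by exact: leq_subr.
rewrite [RHS](big_cat_nat (leq0n _) iM') /=.
rewrite [X in _ = _ + X]big_nat_cond [X in _ = _ + X]big_pred0 ?addr0; last first.
  move=> n; apply/negbTE/negP.
  by have := ltn_ord i; lia.
rewrite [RHS]big_mkcond /=; apply: eq_bigr => n _; case: ltnP => // nM.
by rewrite c0 // nM.
Qed.

Variables (R : realType) (d : int -> nat) (N : nat) (l : ops R d).
Hypotheses (hl : is_Linf l) (hN : strict N l).

Lemma embed_homog i (v : 'rV[R]_(d i)) : homog i (embed v).
Proof. by move=> j ji; rewrite /embed; case: eqP => // e; rewrite e eqxx in ji. Qed.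

Lemma embed_at i (v : 'rV[R]_(d i)) : embed v i = v.
Proof. by rewrite /embed; case: eqP => // e; rewrite (eq_axiomK e). Qed.

Lemma homog_embed i (x : GV R d) : homog i x -> x = embed (x i).
Proof.
move=> hx; apply: functional_extensionality_dep => j; have [<-|ij] := eqVneq i j.
  by rewrite embed_at.
by rewrite hx 1?eq_sym // embed_homog // eq_sym.
Qed.

Lemma gcomb_embed i (c : R) (y z : 'rV[R]_(d i)) :
  embed (c *: y + z) = gcomb c (embed y) (embed z).
Proof.
apply: functional_extensionality_dep => j; rewrite /gcomb.
have [<-|ij] := eqVneq i j; first by rewrite !embed_at.
by rewrite !embed_homog ?scaler0 ?addr0 // eq_sym.
Qed.

Lemma lk0_multilinear k : multilinear (@lk0 R d l k).
Proof.
move=> v a0 c y z; rewrite /lk0.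
have E w : (fun a => @embed R d 0 (upd v a0 w a)) =
    (fun a => if a == a0 then embed w else embed (v a)).
  by apply/funext => a; rewrite /upd; case: eqP.
rewrite !E gcomb_embed.
apply: (Linf_multilin hl (s := fun=> 0)); first by move=> a; exact: embed_homog.
  exact: embed_homog.
exact: embed_homog.
Qed.

Lemma lk0_strict k v : (N <= k)%N -> @lk0 R d l k v = 0.
Proof.
by move=> Nk; apply: (hN (s := fun=> 0)) => // a; exact: embed_homog.
Qed.

Lemma lk0_0 v : @lk0 R d l 0 v = 0. Proof. exact: Linf_l0. Qed.

(** The output has degree [0 + 1], so its component of degree 1 determines it and it can be fed to
    another operation. *)
Lemma l_diag k (u : 'rV[R]_(d 0)) :
  l (fun _ : 'I_k => embed u) = embed (lk0 l (fun _ : 'I_k => u)).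
Proof.
apply: (@homog_embed 1).
have := Linf_deg hl (x := fun _ : 'I_k => embed u) (s := fun=> 0)
  (fun=> @embed_homog 0 u).
by rewrite big1 ?add0r.
Qed.

Definition l_mixed k (u : 'rV[R]_(d 0)) (w : 'rV[R]_(d 1)) : 'rV[R]_(d 2) :=
  l (fun b : 'I_k => if val b == 0%N then embed w else embed u) 2.

Let mixdeg k (b : 'I_k) : int := if val b == 0%N then 1 else 0.

Let mix_homog k (u : 'rV[R]_(d 0)) (w : 'rV[R]_(d 1)) :
  all_homog (fun b : 'I_k => if val b == 0%N then embed w else embed u) (@mixdeg k).
Proof. by move=> b; rewrite /mixdeg; case: eqP => _; exact: embed_homog. Qed.

Lemma l_mixed_linear k u c y z :
  l_mixed k.+1 u (c *: y + z) = c *: l_mixed k.+1 u y + l_mixed k.+1 u z.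
Proof.
have E (w : 'rV[R]_(d 1)) :
    (fun b : 'I_k.+1 => if val b == 0%N then embed w else embed u) =
    (fun b => if b == ord0 then embed w
              else (if val b == 0%N then @embed R d 1 0 else embed u)).
  by apply/funext => b; rewrite -(inj_eq val_inj) /=; case: eqP.
rewrite /l_mixed !E gcomb_embed.
by apply: (Linf_multilin hl (s := @mixdeg k.+1)); [exact: mix_homog|exact: embed_homog..].
Qed.

Lemma l_mixed0 k u : l_mixed k.+1 u 0 = 0.
Proof.
have := l_mixed_linear k u 1 0 0; rewrite !scale1r addr0 => /eqP.
by rewrite -subr_eq0 opprD addrA subrr sub0r oppr_eq0 => /eqP.
Qed.

Lemma l_mixed_sum k u I (r : seq I) (c : I -> R) (y : I -> 'rV_(d 1)) :
  l_mixed k.+1 u (\sum_(i <- r) c i *: y i) = \sum_(i <- r) c i *: l_mixed k.+1 u (y i).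
Proof.
elim: r => [|i r ih]; first by rewrite !big_nil l_mixed0.
by rewrite !big_cons l_mixed_linear ih.
Qed.

Lemma l_mixed_strict k u w : (N <= k)%N -> l_mixed k u w = 0.
Proof. by move=> Nk; apply: (hN (s := @mixdeg k)) => //; exact: mix_homog. Qed.

Lemma l_mixed1 u w : l_mixed 1 u w = l11 l w.
Proof.
rewrite /l_mixed /l11; congr (@l 1%N _ 2).
by apply/funext => b; rewrite ord1.
Qed.

(** Inputs of degree 0 have trivial Koszul signs and all inputs agree, so each unshuffle contributes
    the same term. The added index [i = 0] contributes nothing because [l_0 = 0]. *)
Lemma jacobi_diag m (u : 'rV[R]_(d 0)) :
  \sum_(i < m.+2) 'C(m.+1, i)%:R *: l_mixed (m.+2 - i) u (lk0 l (fun _ : 'I_i => u)) = 0.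
Proof.
rewrite -[RHS](Linf_jacobi hl (x := fun _ : 'I_m.+1 => embed u) (s := fun=> 0)
  (fun=> @embed_homog 0 u) 2).
rewrite -(big_mkord xpredT (fun i =>
  'C(m.+1, i)%:R *: l_mixed (m.+2 - i) u (lk0 l (fun _ : 'I_i => u)))).
rewrite big_ltn // lk0_0 subn0 l_mixed0 scaler0 add0r big_nat [RHS]big_nat.
apply: eq_bigr => i /andP[_ im].
rewrite (eq_bigr (fun=> l_mixed (m.+2 - i) u (lk0 l (fun _ : 'I_i => u)))).
  rewrite sumr_const scaler_nat -card_unshuffle //; congr (_ *+ _).
  by apply: eq_card => σ; rewrite inE.
move=> σ _; rewrite /koszul big1 ?expr0 ?scale1r /l_mixed ?l_diag //.
by move=> a _; apply: big1 => b _; rewrite mul0r.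
Qed.

Lemma MC_full u : MC N l u = \sum_(k < N.+1) (k`!%:R)^-1 *: lk0 l (fun _ : 'I_k => u).
Proof.
rewrite -(big_mkord xpredT (fun k => (k`!%:R)^-1 *: lk0 l (fun _ : 'I_k => u))).
by rewrite big_ltn // lk0_0 scaler0 add0r.
Qed.

Lemma bianchi u :
  l11 l (MC N l u) = - \sum_(1 <= j < N.+1) (j`!%:R)^-1 *: l_mixed j.+1 u (MC N l u).
Proof.
(* The left-hand side becomes the term [j = 0] of the sum, and the claim is that the sum over all
   [j] vanishes. *)
apply/eqP; rewrite -subr_eq0 opprK -(l_mixed1 u) -[l_mixed 1 _ _]scale1r.
rewrite -{1}invr1 -[1 in X in X *: _]/(0`!%:R) -big_ltn //; apply/eqP.
pose c j k := ((j`!%:R)^-1 * (k`!%:R)^-1 : R) *: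
  l_mixed j.+1 u (lk0 l (fun _ : 'I_k => u)).
transitivity (\sum_(j < N.+1) \sum_(k < N.+1) c j k).
  rewrite big_mkord; apply: eq_bigr => j _; rewrite MC_full l_mixed_sum scaler_sumr.
  by apply: eq_bigr => k _; rewrite scalerA.
rewrite -sum_triangle; last first.
  move=> j k; rewrite /c; case/orP => h.
    by rewrite l_mixed_strict ?scaler0 // ltnW // ltnW.
  by rewrite lk0_strict ?l_mixed0 ?scaler0 // ltnW.
(* The antidiagonal [n = 0] contains only [l_0]. For [n = m.+1], [1 / ((n - i)! i!) = 'C(n, i) / n!]
   makes it a multiple of the Jacobi identity with [n] equal inputs. *)
apply: big1 => -[[|m] _] _ /=.
  by rewrite big_ord1 /c lk0_0 l_mixed0 scaler0.
transitivity ((m.+1`!%:R)^-1 *: \sum_(i < m.+2)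
    'C(m.+1, i)%:R *: l_mixed (m.+2 - i) u (lk0 l (fun _ : 'I_i => u))).
  rewrite scaler_sumr; apply: eq_bigr => i _; rewrite scalerA /c.
  have im : (i <= m.+1)%N by rewrite -ltnS.
  rewrite -subSn //; congr (_ *: _).
  rewrite -(bin_fact im) !natrM.
  have f0 n : n`!%:R != 0 :> R by rewrite pnatr_eq0 -lt0n fact_gt0.
  have b0 : 'C(m.+1, i)%:R != 0 :> R by rewrite pnatr_eq0 -lt0n bin_gt0.
  by field; rewrite ?f0 ?b0.
by rewrite jacobi_diag scaler0.
Qed.

Lemma l_mixed_bounded k : exists2 C : R, 0 <= C &
  forall u w, `|l_mixed k.+1 u w| <= C * (`|w| * `|u| ^+ k).
Proof.
(* Over V_0 (+) V_1 the mixed operation has all its arguments in one space. *)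
pose g (v : 'I_k.+1 -> 'rV[R]_(d 0 + d 1)) : 'rV[R]_(d 2) :=
  l (fun b => if val b == 0%N then embed (rsubmx (v b)) else embed (lsubmx (v b))) 2.
have hg : multilinear g.
  move=> v a0 c y z; rewrite /g.
  pose e (b : 'I_k.+1) (x : 'rV[R]_(d 0 + d 1)) : GV R d :=
    if val b == 0%N then @embed _ _ 1 (rsubmx x) else @embed _ _ 0 (lsubmx x).
  have E w : (fun b => if val b == 0%N then embed (rsubmx (upd v a0 w b))
       else embed (lsubmx (upd v a0 w b))) =
      (fun b => if b == a0 then e a0 w else e b (v b)).
    by apply/funext => b; rewrite /upd /e; case: (eqVneq b a0) => [->|].
  have ->: (fun b => if val b == 0%N then embed (rsubmx (upd v a0 (c *: y + z) b))
       else embed (lsubmx (upd v a0 (c *: y + z) b))) =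
    (fun b => if b == a0 then gcomb c (e a0 y) (e a0 z) else e b (v b)).
    rewrite E; apply/funext => b; case: eqP => // _; rewrite /e.
    by case: eqP => _; rewrite !linearP gcomb_embed.
  have eh b x : homog (mixdeg b) (e b x).
    by rewrite /mixdeg /e; case: eqP => _; exact: embed_homog.
  by rewrite !E; apply: (Linf_multilin hl (s := @mixdeg k.+1));
    [move=> b; exact: eh|exact: eh..].
have [C C0 hC] := multilinear_bounded hg (norm_is_norm R (d 2)).
exists C => // u w.
have -> : l_mixed k.+1 u w =
    g (fun b => if val b == 0%N then row_mx 0 w else row_mx u 0).
  rewrite /g /l_mixed; congr (@l k.+1 _ 2); apply/funext => b.
  by case: eqP => _; rewrite ?row_mxKr ?row_mxKl.
apply: le_trans (hC _) _; apply: ler_wpM2l => //.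
rewrite big_ord_recl /=; apply: ler_pM => //.
- exact: prodr_ge0.
- apply: row_norm_le => // j; rewrite mxE.
  case: fintype.split => i; rewrite ?mxE ?normr0 //.
  exact: row_norm_ge.
- rewrite (_ : `|u| ^+ k = \prod_(i < k) `|u|); last by rewrite prodr_const card_ord.
  apply: ler_prod => j _; rewrite normr_ge0 /=.
  apply: row_norm_le => // i; rewrite mxE.
  case: fintype.split => i'; rewrite ?mxE ?normr0 //.
  exact: row_norm_ge.
Qed.

(** Every term of the Bianchi sum has [j >= 1] entries [u], and [|u| ^+ j <= |u|] when
    [|u| <= 1]. *)
Lemma bianchi_bound : exists2 C : R, 0 <= C & forall u, `|u| <= 1 ->
  `|l11 l (MC N l u)| <= C * (`|u| * `|MC N l u|).
Proof.
have /choice[C hC] : forall j, exists C : R, 0 <= C /\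
    forall u w, `|l_mixed j.+1 u w| <= C * (`|w| * `|u| ^+ j).
  by move=> j; have [C ? ?] := l_mixed_bounded j; exists C.
exists (\sum_(1 <= j < N.+1) C j).
  by apply: sumr_ge0 => j _; have [] := hC j.
move=> u u1; rewrite bianchi normrN mulr_suml.
apply: le_trans (ler_norm_sum _ _ _) _; rewrite big_nat [leRHS]big_nat.
apply: ler_sum => j /andP[j1 _]; have [Cj0 hCj] := hC j.
rewrite normrZ ger0_norm ?invr_ge0 //.
apply: (@le_trans _ _ (1 * `|l_mixed j.+1 u (MC N l u)|)).
  by apply: ler_wpM2r => //; rewrite invf_le1 ?ler1n ?ltr0n fact_gt0.
rewrite mul1r; apply: le_trans (hCj _ _) _; apply: ler_wpM2l => //.
rewrite mulrC; apply: ler_wpM2r => //.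
by rewrite -{2}[`|u|]expr1; apply: ler_wiXn2l.
Qed.

End Bianchi.

(** * The deformation *)

Section Deformation.
Set Implicit Arguments. Unset Strict Implicit.
Variables (R : realType) (d : int -> nat) (N : nat) (l : ops R d).
Hypotheses (hl : is_Linf l) (hN : strict N l).
Variables (h1 : {linear 'rV[R]_(d 1) -> 'rV[R]_(d 0)})
  (h2 : {linear 'rV[R]_(d 2) -> 'rV[R]_(d 1)}).
Hypothesis hh : forall w : 'rV[R]_(d 1), l10 l (h1 w) + h2 (l11 l w) = w.
Variables (N0 : 'rV[R]_(d 0) -> R) (N1 : 'rV[R]_(d 1) -> R).
Hypotheses (hN0 : is_norm N0) (hN1 : is_norm N1).

Local Notation op := (opnorm_l N0 N1 l).
Local Notation H := (opnorm N1 N0 h1).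
Local Notation alpha := (alpha_l N0 N1 N l).

Lemma l10_linear c y z : l10 l (c *: y + z) = c *: l10 l y + l10 l z.
Proof.
have E w : upd (fun _ : 'I_1 => 0 : 'rV[R]_(d 0)) ord0 w = (fun=> w).
  by apply/funext => a; rewrite /upd ord1.
by have := lk0_multilinear hl (fun _ : 'I_1 => 0) ord0 c y z; rewrite !E.
Qed.

Lemma l10_0 : l10 l 0 = 0.
Proof.
have := l10_linear 1 0 0; rewrite !scale1r addr0 => /eqP.
by rewrite -subr_eq0 opprD addrA subrr sub0r oppr_eq0 => /eqP.
Qed.

Lemma l10D y z : l10 l (y + z) = l10 l y + l10 l z.
Proof. by have := l10_linear 1 y z; rewrite !scale1r. Qed.

Lemma l11D y z : l11 l (y + z) = l11 l y + l11 l z.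
Proof. by rewrite -!(l_mixed1 l 0) -[y in LHS]scale1r l_mixed_linear // scale1r. Qed.

Lemma l11_l10 v : l11 l (l10 l v) = 0.
Proof.
have := jacobi_diag hl 0 v.
rewrite big_ord_recr big_ord1 /= lk0_0 // l_mixed0 // scaler0 add0r scale1r.
by rewrite subSnn l_mixed1.
Qed.

Lemma op_ge0 k : 0 <= op k.
Proof. exact: (multilinear_sup_ge0 (lk0_multilinear hl (k := k)) hN0 hN1). Qed.

Lemma lk0_le_op k (v : 'I_k -> 'rV_(d 0)) : N1 (lk0 l v) <= op k * \prod_(a < k) N0 (v a).
Proof. exact: (multilinear_le_sup (lk0_multilinear hl (k := k)) hN0 hN1). Qed.

Lemma l10_le_op v : N1 (l10 l v) <= op 1 * N0 v.
Proof.
have := lk0_le_op (fun _ : 'I_1 => v).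
by rewrite big_ord_recl big_ord0 mulr1.
Qed.

Lemma H_ge0 : 0 <= H.
Proof. by apply: opnorm_ge0 => // c y z; rewrite linearP. Qed.

Lemma h1_le_H w : N0 (h1 w) <= H * N1 w.
Proof. by apply: le_opnorm => // c y z; rewrite linearP. Qed.

(** The index list is a parameter so that the same estimates serve [MC], with arities from 1, and
    its nonlinear part, with arities from 2. *)
Definition lk_sum (r : seq nat) (v : 'rV[R]_(d 0)) : 'rV[R]_(d 1) :=
  \sum_(k <- r) (k`!%:R)^-1 *: lk0 l (fun _ : 'I_k => v).

Definition op_sum (r : seq nat) (A : R) : R :=
  \sum_(k <- r) (k`!%:R)^-1 * (op k * A ^+ k).

Lemma lk_sum_wpoly rho r A P : 0 < rho -> 0 <= A -> wpoly rho N0 A P ->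
  wpoly rho N1 (op_sum r A) (fun t => lk_sum r (P t)).
Proof.
move=> rho0 A0 hP.
apply: (@wpoly_sum _ rho _ N1 _ r (fun k => (k`!%:R)^-1 * (op k * A ^+ k))
  (fun k t => (k`!%:R)^-1 *: lk0 l (fun _ : 'I_k => P t))) => k.
have f0 : 0 <= (k`!%:R : R)^-1 by rewrite invr_ge0.
apply: (wpoly_linear rho0 f0 (N0 := N1) (h := fun y => (k`!%:R)^-1 *: y)).
- by move=> c y z; rewrite scalerDr !scalerA mulrC.
- by move=> y; rewrite nmZ // ger0_norm.
- apply: (wpoly_multilinear rho0 hN0 hN1 (lk0_multilinear hl (k := k))) => //.
    exact: op_ge0.
  exact: lk0_le_op.
Qed.

Lemma lk_sum_lipschitz r e : 0 <= e -> exists2 L : R, 0 <= L &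
  forall v w, `|v| <= e -> `|w| <= e -> N1 (lk_sum r v - lk_sum r w) <= L * `|v - w|.
Proof.
move=> e0.
have /choice[C hC] : forall k, exists C : R, 0 <= C /\
    forall v w, `|v| <= e -> `|w| <= e ->
    N1 (lk0 l (fun _ : 'I_k => v) - lk0 l (fun _ : 'I_k => w)) <= C * `|v - w|.
  move=> k; have [C C0 hC] := multilinear_lipschitz (lk0_multilinear hl (k := k)) hN1.
  exists (C * e ^+ k.-1); split; first by rewrite mulr_ge0 ?exprn_ge0.
  move=> v w ve we; rewrite -mulrA [e ^+ _ * _]mulrC.
  by apply: hC.
exists (\sum_(k <- r) (k`!%:R)^-1 * C k).
  by apply: sumr_ge0 => k _; have [? _] := hC k; rewrite mulr_ge0 ?invr_ge0.
move=> v w ve we; rewrite -sumrB mulr_suml.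
apply: le_trans (nm_sum hN1 _ _ _) _; apply: ler_sum => k _.
rewrite -scalerBr nmZ // ger0_norm ?invr_ge0 // -mulrA.
by apply: ler_wpM2l; rewrite ?invr_ge0 //; have [_] := hC k; apply.
Qed.

Lemma lk_sum_0 r : 0%N \notin r -> lk_sum r 0 = 0.
Proof.
move=> r0; rewrite /lk_sum big_seq big1 // => -[|k] kr; first by rewrite kr in r0.
have := multilinear0 (lk0_multilinear hl (k := k.+1)) (fun=> 0) ord0.
rewrite (_ : upd _ _ _ = (fun=> 0)); first by move=> ->; rewrite scaler0.
by apply/funext => a; rewrite /upd; case: eqP.
Qed.

Lemma lk_sum_Opow r j P Q : (forall k, k \in r -> (1 < k)%N) ->
  Opow N0 1 P -> Opow N0 1 Q -> Opow N0 j (fun t => P t - Q t) ->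
  Opow N1 j.+1 (fun t => lk_sum r (P t) - lk_sum r (Q t)).
Proof.
move=> hr OP OQ OPQ; elim: r hr => [|k r ih] hr.
  by apply: Opow_ext (Opow0 hN1 _) => t; rewrite /lk_sum !big_nil subrr.
have hk : Opow N1 j.+1 (fun t => (k`!%:R)^-1 *:
    (lk0 l (fun _ : 'I_k => P t) - lk0 l (fun _ : 'I_k => Q t))).
  have k1 : (1 < k)%N by apply: hr; rewrite mem_head.
  apply: Opow_bounded
    (Opow_multilinear hN0 hN1 (lk0_multilinear hl (k := k)) k1 OP OQ OPQ).
  - exact: hN1.
  - exact: (_ : 0 <= (k`!%:R : R)^-1).
  - by move=> t /=; rewrite nmZ // ger0_norm.
have hi := ih (fun i ir => hr i (mem_behead (s := k :: r) ir)).
apply: Opow_ext (OpowD hN1 hk hi) => t.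
by rewrite /lk_sum !big_cons scalerBr opprD addrACA.
Qed.


(** Near 0 the term [h2 (l11 W)], with [W = MC N l (P t)], is at most half of [W] by the Bianchi
    bound and is absorbed on the left. Hence [W] is at most twice the assumed defect. *)
Lemma MC_Opow k P : Opow N0 1 P ->
  Opow N1 k (fun t => MC N l (P t) - h2 (l11 l (MC N l (P t)))) ->
  Opow N1 k (fun t => MC N l (P t)).
Proof.
move=> [K K0 hK] [E E0 hE].
have [C C0 hC] := bianchi_bound hl hN.
have [c0 c00 hc0] := norm_le_nm hN0; have [c1 c10 hc1] := norm_le_nm hN1.
have h2l c y z : h2 (c *: y + z) = c *: h2 y + h2 z by rewrite linearP.
have h2b := le_opnorm h2l (norm_is_norm R (d 2)) hN1.
have h20 := opnorm_ge0 h2l (norm_is_norm R (d 2)) hN1.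
set G := opnorm _ _ _ in h2b h20.
(* The factors come from [h2], the Bianchi bound, [|P t| <= c0 * K * t], and the passage from [N1]
   to the sup norm. *)
pose M := G * C * c0 * K * c1.
have M0 : 0 <= M by rewrite !mulr_ge0.
have M1 : 0 < 2 * (M + 1) by lra.
have cK1 : 0 < c0 * K + 1 by rewrite ltr_wpDl // mulr_ge0.
exists (2 * E); first by rewrite mulr_ge0.
near=> t.
have t0 : 0 < t by near: t; exact: nbhs_right_gt.
(* This threshold gives [M * t <= 1 / 2]; the next one gives [|P t| <= 1], as the Bianchi bound
   requires. *)
have tM : t <= (2 * (M + 1))^-1 by near: t; apply: nbhs_right_le; rewrite invr_gt0.
have tc : t <= (c0 * K + 1)^-1 by near: t; apply: nbhs_right_le; rewrite invr_gt0.
have ut : `|P t| <= c0 * K * t.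
  apply: le_trans (hc0 _) _; rewrite -mulrA; apply: ler_wpM2l => //.
  by rewrite -{2}[t]expr1; near: t.
have u1 : `|P t| <= 1.
  apply: le_trans ut _; move: tc; rewrite -[_^-1]mul1r ler_pdivlMr // => tc.
  by apply: le_trans tc; rewrite mulrDr mulr1 mulrC lerDl ltW.
have rt : N1 (MC N l (P t) - h2 (l11 l (MC N l (P t)))) <= E * t ^+ k by near: t.
have := hC _ u1; set W := MC N l (P t) in rt * => hCW.
have hW : N1 (h2 (l11 l W)) <= M * t * N1 W.
  apply: le_trans (h2b _) _.
  apply: (@le_trans _ _ (G * (C * ((c0 * K * t) * (c1 * N1 W))))).
    apply: ler_wpM2l => //; apply: le_trans hCW _; apply: ler_wpM2l => //.
    by apply: ler_pM => //; exact: hc1.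
  by rewrite le_eqVlt; apply/orP; left; apply/eqP; rewrite /M; ring.
have W0 : 0 <= N1 W by exact: nm_ge0.
have Mt : M * t <= 2^-1.
  apply: (@le_trans _ _ (M * (2 * (M + 1))^-1)); first exact: ler_wpM2l.
  rewrite ler_pdivrMr //; lra.
have : N1 W <= N1 (W - h2 (l11 l W)) + N1 (h2 (l11 l W)).
  by rewrite -{1}[W](subrK (h2 (l11 l W))); exact: nmD.
have : M * t * N1 W <= 2^-1 * N1 W by exact: ler_wpM2r.
move: rt hW; move: (N1 _) (N1 _) W0 => x y.
rewrite -mulrA; lra.
Unshelve. all: by end_near. Qed.

(** At a fixed [t < 2] the polynomial [MC N l (p k t)] has order [k] and a coefficient norm
    independent of [k], so it is at most a constant times [(t / 3) ^+ k]. Local Lipschitz continuity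
    carries the limit 0 over to [u t]. *)
Lemma deformation_of_approximation A (p : nat -> R -> 'rV[R]_(d 0)) u1 :
    0 <= A -> (forall k, wpoly 3 N0 A (p k)) ->
    (forall k, Opow N0 k.+1 (fun t => p k.+1 t - p k t)) ->
    (forall t, p 0%N t = 0) -> (forall t, p 1%N t = t *: u1) ->
    (forall k, Opow N1 k (fun t => MC N l (p k t))) ->
  exists u : R -> 'rV[R]_(d 0),
    (exists e : R, 0 < e /\ smooth_on [set t | - e < t < 2] u)
    /\ u 0 = 0
    /\ (forall t : R, 0 <= t < 2 -> MC N l (u t) = 0)
    /\ derive1 u 0 = u1.
Proof.
move=> A0 hp hO p0 p1 hMC.
have r0 : 0 < 3 :> R by [].
have [u [us u0 u'0 ulim]] := smooth_limit r0 hN0 hp hO p0 p1.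
exists u; split; [|split => //; split => //].
  exists 3; split => // k t /= /andP[t3 t2]; apply: us => /=.
  by rewrite t3 (lt_trans t2) // ltr_nat.
move=> t /andP[t0 t2].
have t3 : t < 3 by rewrite (lt_trans t2) // ltr_nat.
apply: (nm_eq0 hN1); apply/eqP; rewrite eq_le nm_ge0 // andbT.
apply/ler_addgt0Pl => e e0; rewrite addr0.
have [c c0 hc] := norm_le_nm hN0.
(* Sup-norm radius of a ball containing [u t] and every [p k t] at [N0]-distance at most 1 from
   it. *)
pose b := c * (N0 (u t) + 1).
have b0 : 0 <= b by rewrite mulr_ge0 // addr_ge0 // nm_ge0.
have [L L0 hL] := lk_sum_lipschitz (index_iota 1 N.+1) b0.
pose B := op_sum (index_iota 1 N.+1) A.
have q0 : 0 <= t / 3 by rewrite divr_ge0.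
have q1 : `|t / 3| < 1 by rewrite ger0_norm // ltr_pdivrMr // mul1r.
have Lc1 : 0 < 2 * (L * c + 1) by rewrite mulr_gt0 // ltr_wpDl // mulr_ge0.
near \oo => k.
have pu1 : N0 (p k t - u t) <= 1 by near: k; apply: ulim; rewrite ?t0.
have pu : N0 (p k t - u t) <= e / (2 * (L * c + 1)).
  by near: k; apply: ulim; rewrite ?t0 // divr_gt0.
have Bk : B * (t / 3) ^+ k <= e / 2.
  apply: le_trans (ler_norm _) _; near: k; apply: cvgr0_norm_le; last by rewrite divr_gt0.
  exact: (cvg_geometric B q1).
have h1k : N1 (MC N l (p k t)) <= e / 2.
  apply: le_trans Bk; apply: (wpoly_Opow r0 hN1 _ (hMC k)); last by rewrite t0 ltW.
  exact: lk_sum_wpoly.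
have h2k : N1 (MC N l (u t) - MC N l (p k t)) <= e / 2.
  apply: le_trans (hL _ _ _ _) _.
  - by apply: le_trans (hc _) _; apply: ler_wpM2l => //; rewrite lerDl.
  - apply: le_trans (hc _) _; apply: ler_wpM2l => //.
    rewrite -[p k t](subrK (u t)) addrC; apply: le_trans (nmD hN0 _ _) _.
    by rewrite addrC [leRHS]addrC lerD2r.
  rewrite distrC; apply: (@le_trans _ _ (L * (c * (e / (2 * (L * c + 1)))))).
    by apply: ler_wpM2l => //; apply: le_trans (hc _) _; exact: ler_wpM2l.
  rewrite !mulrA ler_pdivrMr //.
  have -> : e / 2 * (2 * (L * c + 1)) = e * (L * c + 1) by field.
  by rewrite mulrC; apply: ler_wpM2l; [exact: ltW|rewrite lerDl].
rewrite -[MC N l (u t)](subrK (MC N l (p k t))).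
apply: le_trans (nmD hN1 _ _) _; rewrite [leRHS]splitr; exact: lerD.
Unshelve. all: by end_near. Qed.

Lemma deformation_l10_zero u1 : (forall v, l10 l v = 0) ->
  exists u : R -> 'rV[R]_(d 0),
    (exists e : R, 0 < e /\ smooth_on [set t | - e < t < 2] u)
    /\ u 0 = 0
    /\ (forall t : R, 0 <= t < 2 -> MC N l (u t) = 0)
    /\ derive1 u 0 = u1.
Proof.
(* With [l10 = 0] the homotopy identity reads [w = h2 (l11 w)], so the defect in [MC_Opow] is
   exactly 0. The family is constant after the zero start, with coefficient norm [3 * N0 u1]. *)
move=> l0; pose p (k : nat) (t : R) := if k is 0%N then 0 else t *: u1.
have r0 : 0 < 3 :> R by [].
have Op k : Opow N0 1 (p k).
  by case: k => [|k]; [exact: Opow0|exact: Opow_monomial].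
apply: (@deformation_of_approximation (3 * N0 u1) p) => //.
- by rewrite mulr_ge0 // nm_ge0.
- move=> [|k]; first by apply: wpoly_le (wpoly0 _ _); rewrite mulr_ge0 // nm_ge0.
  have := wpoly_monomial 3 N0 1 u1; rewrite expr1.
  by apply: wpoly_ext => t; rewrite expr1.
- move=> [|k]; first by apply: Opow_ext (Opow_monomial hN0 u1) => t; rewrite subr0.
  by apply: Opow_ext (Opow0 hN0 _) => t; rewrite subrr.
- move=> k; apply: MC_Opow => //; apply: Opow_ext (Opow0 hN1 k) => t.
  by rewrite -{1}[MC N l _]hh l0 add0r subrr.
Qed.

(** * Picard iteration when [l10] is nonzero *)

Section Picard.
Variables (u1 : 'rV[R]_(d 0)) (v0 : 'rV[R]_(d 0)).
Hypotheses (hu1 : l10 l u1 = 0) (l0 : l10 l v0 != 0).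
Hypothesis hsmall : N0 u1 * (12 * H * alpha) < 1.

Let r2 := index_iota 2 N.+1.
Let M2 := lk_sum r2.

Lemma N_gt1 : (1 < N)%N.
Proof.
rewrite ltnNge; apply/negP => N1'; move: l0.
by rewrite /l10 -/(lk0 l (fun=> v0)) (lk0_strict hN) // eqxx.
Qed.

Lemma MC_split v : MC N l v = l10 l v + M2 v.
Proof.
have N1' := N_gt1.
by rewrite /MC big_ltn ?ltnS 1?ltnW // invr1 scale1r.
Qed.

Lemma alpha_split : alpha = op 1 + op_sum r2 1.
Proof.
have N1' := N_gt1.
rewrite /alpha_l big_ltn ?ltnS 1?ltnW // divr1; congr (_ + _).
by apply: eq_bigr => k _; rewrite expr1n mulr1 mulrC.
Qed.

(** Only arities [k >= 2] occur, and [A ^+ k <= A ^+ 2] for [A <= 1]. *)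
Lemma op_sum_le A : 0 <= A <= 1 -> op_sum r2 A <= alpha * A ^+ 2.
Proof.
move=> /andP[A0 A1]; apply: (@le_trans _ _ (op_sum r2 1 * A ^+ 2)).
  rewrite /op_sum mulr_suml big_nat [leRHS]big_nat; apply: ler_sum => k /andP[k2 _].
  rewrite expr1n mulr1 -mulrA; apply: ler_wpM2l; first by rewrite invr_ge0.
  by apply: ler_wpM2l; [exact: op_ge0|exact: ler_wiXn2l].
by apply: ler_wpM2r; rewrite ?exprn_ge0 // alpha_split lerDr op_ge0.
Qed.

(** As [l11 (l10 v0) = 0], the homotopy identity [hh] reads
    [l10 (h1 (l10 v0)) = l10 v0]. *)
Lemma H_alpha_ge1 : 1 <= H * alpha.
Proof.
have N1' := N_gt1.
have e0 : 0 < N1 (l10 l v0).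
  rewrite lt_neqAle nm_ge0 // andbT eq_sym; apply/eqP => /(nm_eq0 hN1) h.
  by move: l0; rewrite h eqxx.
have : N1 (l10 l v0) <= op 1 * (H * N1 (l10 l v0)).
  have := hh (l10 l v0); rewrite l11_l10 linear0 addr0 => {1}<-.
  apply: le_trans (l10_le_op _) _; apply: ler_wpM2l; [exact: op_ge0|exact: h1_le_H].
rewrite mulrA -[leLHS]mul1r ler_pM2r // => h; apply: le_trans h _.
rewrite mulrC; apply: ler_wpM2l; first exact: H_ge0.
rewrite alpha_split lerDl; apply: sumr_ge0 => k _.
by rewrite expr1n mulr1 mulr_ge0 ?invr_ge0 // op_ge0.
Qed.

Let p (k : nat) : R -> 'rV[R]_(d 0) :=
  iter k (fun f t => t *: u1 - h1 (M2 (f t))) (fun=> 0).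

Let r2_gt1 k : k \in r2 -> (1 < k)%N.
Proof. by rewrite mem_index_iota => /andP[]. Qed.

Let M2_0 : M2 0 = 0.
Proof. by apply: lk_sum_0; rewrite mem_index_iota. Qed.

Let h1M2_Opow j P Q : Opow N0 1 P -> Opow N0 1 Q -> Opow N0 j (fun t => P t - Q t) ->
  Opow N0 j.+1 (fun t => h1 (M2 (P t)) - h1 (M2 (Q t))).
Proof.
move=> OP OQ OPQ.
apply: Opow_bounded (lk_sum_Opow r2_gt1 OP OQ OPQ); [exact: hN1|exact: H_ge0|].
by move=> t; rewrite -linearB; exact: h1_le_H.
Qed.

Let p_Opow k : Opow N0 1 (p k).
Proof.
elim: k => [|k ih]; first exact: Opow0.
have h : Opow N0 1 (fun t => - (h1 (M2 (p k t)))).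
  (* The iterate is compared with the zero path at order 0, which yields order 1 for
     [h1 (M2 (p k t))]. *)
  have := h1M2_Opow (Opow0 hN0 1) ih (j := 0).
  rewrite M2_0 linear0 => h; apply: Opow_ext (h _) => [t|]; first by rewrite sub0r.
  have [C C0 hC] := ih; exists C => //; near=> t.
  have t0 : 0 < t by near: t; exact: nbhs_right_gt.
  have t1 : t <= 1 by near: t; exact: nbhs_right_le.
  rewrite sub0r nmN // expr0; apply: (@le_trans _ _ (C * t ^+ 1)); first by near: t.
  by apply: ler_wpM2l.
exact: (OpowD hN0 (Opow_monomial hN0 u1) h).
Unshelve. all: by end_near. Qed.

(** The linear terms [t *: u1] cancel between successive iterates, and each application of [h1]
    after [M2] raises the order of the difference by one. *)
Let p_step k : Opow N0 k.+1 (fun t => p k.+1 t - p k t).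
Proof.
elim: k => [|k ih].
  apply: Opow_ext (Opow_monomial hN0 u1) => t.
  by rewrite /p /= M2_0 linear0 !subr0.
apply: Opow_ext (h1M2_Opow (p_Opow k) (p_Opow k.+1) (j := k.+1) _) => [t|].
  have pS i : p i.+1 t = t *: u1 - h1 (M2 (p i t)) by [].
  by rewrite (pS k.+1) [in X in _ = _ - X]pS opprB [RHS]addrC addrA subrK.
apply: Opow_bounded ih; [exact: hN0|exact: ler01|].
by move=> t; rewrite mul1r -nmN // opprB.
Qed.

Lemma deformation_picard : exists u : R -> 'rV[R]_(d 0),
    (exists e : R, 0 < e /\ smooth_on [set t | - e < t < 2] u)
    /\ u 0 = 0
    /\ (forall t : R, 0 <= t < 2 -> MC N l (u t) = 0)
    /\ derive1 u 0 = u1.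
Proof.
have r0 : 0 < 3 :> R by [].
have H0 := H_ge0; have Ha := H_alpha_ge1.
set x := H * alpha in Ha.
have x0 : 0 < x by lra.
(* [A] maximises [A - x A^2], with maximum [1 / (4 x)]: together with the radius
   [3] of [wpoly], this is where the constant [12 = 3 * 4] comes from. *)
pose A := (2 * x)^-1.
have A0 : 0 <= A by rewrite invr_ge0; lra.
(* The bound [1 <= x] enters here; [op_sum_le] is available only for [A <= 1]. *)
have A1 : A <= 1 by rewrite invf_le1; lra.
have Ax : x * A ^+ 2 = A / 2 by rewrite /A; field; lra.
have uA : 3 * N0 u1 <= A / 2.
  have -> : A / 2 = (4 * x)^-1 by rewrite /A; field; lra.
  rewrite -[leRHS]mul1r ler_pdivlMr; last lra.
  by move: hsmall; rewrite -mulrA -/x; lra.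
apply: (@deformation_of_approximation A p) => //.
- elim=> [|k ih]; first by apply: wpoly_le (wpoly0 _ _).
  have hm : wpoly 3 N0 (3 * N0 u1) (fun t => t *: u1).
    have := wpoly_monomial 3 N0 1 u1; rewrite expr1.
    by apply: wpoly_ext => t; rewrite expr1.
  have hM : wpoly 3 N0 (H * op_sum r2 A) (fun t => - h1 (M2 (p k t))).
    apply: (wpoly_linear r0 H0 (N0 := N1) (h := fun w => - h1 w)).
    - by move=> c y z; rewrite linearP opprD scalerN.
    - by move=> y; rewrite nmN //; exact: h1_le_H.
    - exact: lk_sum_wpoly.
  apply: wpoly_le (wpolyD hm hM).
  have : H * op_sum r2 A <= H * (alpha * A ^+ 2).
    by apply: ler_wpM2l => //; apply: op_sum_le; rewrite A0.
  rewrite mulrA -/x Ax; lra.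
- by move=> t; rewrite /p /= M2_0 linear0 subr0.
- move=> k; apply: MC_Opow => //.
  have O10 : Opow N1 k.+1 (fun t => l10 l (p k.+1 t - p k t)).
    apply: Opow_bounded (p_step k); [exact: hN0|exact: (op_ge0 1)|].
    by move=> t; exact: l10_le_op.
  apply: Opow_weak (leqnSn k) _.
  apply: Opow_bounded O10; [exact: hN1|exact: ler01|].
  move=> t; rewrite mul1r -[leRHS](nmN hN1) le_eqVlt; apply/orP; left; apply/eqP.
  congr N1.
  (* By the homotopy identity the defect is [l10] of [p k t + h1 (M2 (p k t))]. As [l10 u1 = 0],
     this is minus [l10] of the Picard step, of order [k.+1]. *)
  have E : MC N l (p k t) - h2 (l11 l (MC N l (p k t))) =
      l10 l (p k t) + l10 l (h1 (M2 (p k t))).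
    rewrite MC_split l11D l11_l10 add0r -{1}[M2 (p k t)]hh.
    by rewrite addrA addrK.
  have -> : p k.+1 t - p k t = t *: u1 + -1 *: (p k t + h1 (M2 (p k t))).
    by rewrite scaleN1r opprD addrA addrAC.
  by rewrite E l10_linear hu1 scaler0 add0r -[-1 *: _]addr0 l10_linear
    l10_0 addr0 scaleN1r opprK l10D.
Qed.

End Picard.
End Deformation.

Theorem theorem5p16 (R : realType) (d : int -> nat) (N : nat) (l : ops R d)
  (hl : is_Linf l) (hN : strict N l)
  (hH1 : forall w : 'rV[R]_(d 1), l11 l w = 0 -> exists v, l10 l v = w)
  (h1 : {linear 'rV[R]_(d 1) -> 'rV[R]_(d 0)})
  (h2 : {linear 'rV[R]_(d 2) -> 'rV[R]_(d 1)})
  (hh : forall w : 'rV[R]_(d 1), l10 l (h1 w) + h2 (l11 l w) = w)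
  (N0 : 'rV[R]_(d 0) -> R) (N1 : 'rV[R]_(d 1) -> R)
  (hN0 : is_norm N0) (hN1 : is_norm N1)
  (u1 : 'rV[R]_(d 0)) (hu1 : l10 l u1 = 0)
  (hsmall : N0 u1 * (12 * opnorm N1 N0 h1 * alpha_l N0 N1 N l) < 1) :
  exists u : R -> 'rV[R]_(d 0),
    (exists e : R, 0 < e /\ smooth_on [set t | - e < t < 2] u)
    /\ u 0 = 0
    /\ (forall t : R, 0 <= t < 2 -> MC N l (u t) = 0)
    /\ derive1 u 0 = u1.
Proof.
have [[v0 l0]|l0] := pselect (exists v, l10 l v != 0).
  exact: (deformation_picard hl hN hh hN0 hN1 hu1 l0 hsmall).
apply: (deformation_l10_zero hl hN hh hN0 hN1) => v.
by apply/eqP/negPn/negP => h; apply: l0; exists v.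
Qed.
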